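(* Consider the closed-loop system described in the context, with error state $\mathbf{z}=[\mathbf{e}_v^{\mathrm T}\ \boldsymbol{\eta}^{\mathrm T}]^{\mathrm T}\in\mathbb{R}^6$ and constants $a_1,a_2,c_c,d_v,A_q,A_v,A_c$ as defined there. Let $\mu_0=\lambda_{\min}\{\mathbf{K}_P\}-A_v-d_v$ and assume $\mu_0>0$; let $\chi=c_c+\lambda_{\max}\{\mathbf{K}_P\}+d_v+A_v$, let $$0<\delta<\min\left\{\frac{\min\{a_1,\lambda_{\min}\{\mathbf{K}_I\}\}}{a_2},\ \frac{\mu_0}{2a_2+2\chi^2/\lambda_{\min}\{\mathbf{K}_I\}}\right\},$$ and let $$W=\tfrac12\mathbf{e}_v^{\mathrm T}\tilde{\mathbf{M}}(\mathbf{q})\mathbf{e}_v+\tfrac12\boldsymbol{\eta}^{\mathrm T}\mathbf{K}_I\boldsymbol{\eta}+\delta\,\mathbf{e}_v^{\mathrm T}\tilde{\mathbf{M}}(\mathbf{q})\boldsymbol{\eta}.$$ Let $\underline{\alpha},\overline{\alpha},c_1,c_2,c_3,c_4$ be the positive constants (which exist under these conditions) such that $\underline{\alpha}\|\mathbf{z}\|^2\le W\le\overline{\alpha}\|\mathbf{z}\|^2$ and, along all closed-loop trajectories, $\dot W\le-c_1\|\mathbf{e}_v\|^2-c_2\|\boldsymbol{\eta}\|^2+c_3\|\mathbf{q}-\mathbf{q}_d\|^2+c_4$, one explicit choice being $$\underline{\alpha}=\tfrac12\min\{a_1-\delta a_2,\ \lambda_{\min}\{\mathbf{K}_I\}-\delta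 a_2\},\qquad \overline{\alpha}=\tfrac12\max\{a_2+\delta a_2,\ \lambda_{\max}\{\mathbf{K}_I\}+\delta a_2\},$$ $$c_1=\frac{\mu_0}{2}-\delta\Big(a_2+\frac{\chi^2}{\lambda_{\min}\{\mathbf{K}_I\}}\Big),\quad c_2=\frac{\delta}{4}\lambda_{\min}\{\mathbf{K}_I\},\quad c_3=\frac{A_q^2}{\mu_0}+\delta\frac{A_q^2}{\lambda_{\min}\{\mathbf{K}_I\}},\quad c_4=\frac{A_c^2}{\mu_0}+\delta\frac{A_c^2}{\lambda_{\min}\{\mathbf{K}_I\}}.$$ Suppose that the reference signals generated by the virtual kinematic controller are bounded on the considered operating set, and that there exists a constant $\bar q\ge0$ such that $$\|\mathbf{q}(t)-\mathbf{q}_d(t)\|\le\bar q\quad\text{for all } t\ge0.$$ Let $c=\min\{c_1,c_2\}$ and $\bar\rho=c_3\bar q^2+c_4$. Then, along all closed-loop trajectories, $$\dot W\le-c\|\mathbf{z}\|^2+\bar\rho,$$ and, equivalently, $$\dot W\le-\frac{c}{\overline{\alpha}}W+\bar\rho.$$ Hence $$W(t)\le e^{-\frac{c}{\overline{\alpha}}t}W(0)+\frac{\overline{\alpha}}{c}\bar\rho\left(1-e^{-\frac{c}{\overline{\alpha}}t}\right)\quad\text{for all }t\ge0,$$ and the error state $\mathbf{z}$ is uniformly ultimately bounded. In particular, $$\limsup_{t\to\infty}\|\mathbf{z}(t)\|\le\sqrt{\frac{\overline{\alpha}}{\underline{\alpha}}\,\frac{\bar\rho}{c}} .$$ Moreover,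 in the nominal case for which $\mathbf{q}(t)\equiv\mathbf{q}_d(t)$ and $A_c=0$, one has $\bar\rho=0$ and therefore the equilibrium $\mathbf{z}=0$ is exponentially stable on the operating set.
   Context: Norms: $\|\cdot\|$ is the Euclidean norm on vectors and the induced $2$-norm on matrices; $\lambda_{\min}\{\cdot\},\lambda_{\max}\{\cdot\}$ are the smallest and largest eigenvalues of a symmetric matrix. In the reduced-coordinate estimates, $\|\mathbf{v}\|$ is interpreted as a scaled norm in which the steering-rate components are understood through the characteristic length $a$ of the robot (so that $v_w,a\dot\delta_f,a\dot\delta_r$ form a dimensionally consistent measure), and the bound $\sigma_J$ below is interpreted in the same scaled metric. Robot model. Parameters $m,I,I_\varphi,I_\delta,r,a,b>0$ and $A=\frac{a}{2(a^2+b^2)}$. Configuration $\mathbf{q}=[x\ y\ \theta\ \varphi\ \delta_f\ \delta_r]^{\mathrm T}\in\mathbb{R}^6$, reduced velocity $\mathbf{v}=[v_w\ \omega_f\ \omega_r]^{\mathrm T}\in\mathbb{R}^3$, kinematics $\dot{\mathbf{q}}=\mathbf{J}(\mathbf{q})\mathbf{v}$ (so $\dot\delta_f=\omega_f$, $\dot\delta_r=\omega_r$), where $\mathbf{J}(\mathbf{q})\in\mathbb{R}^{6\times3}$ has first column $$\big[\tfrac12(\cos(\delta_f+\theta)+\cos(\delta_r+\theta)),\ \tfrac12(\sin(\delta_f+\theta)+\sin(\delta_r+\theta)),\ A(\sin\delta_f-\sin\delta_r),\ r^{-1},\ 0,\ 0\big]^{\mathrm T}$$ and second and third columns the standard basis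 vectors $e_5,e_6$ of $\mathbb{R}^6$. The reduced dynamics are $$\tilde{\mathbf{M}}(\mathbf{q})\dot{\mathbf{v}}+\tilde{\mathbf{C}}(\mathbf{q},\dot{\mathbf{q}})\mathbf{v}=\tilde{\mathbf{B}}(\mathbf{q})\boldsymbol{\tau}-\tilde{\mathbf{f}}(\mathbf{q},\mathbf{v}),$$ with input $\boldsymbol\tau\in\mathbb{R}^3$ and $\tilde{\mathbf{M}}=\mathrm{diag}(\tilde M_{11},2I_\delta,2I_\delta)$, $\tilde M_{11}=\frac{4I_\varphi}{r^2}+\frac m2(1+\cos(\delta_f-\delta_r))+IA^2(\sin\delta_f-\sin\delta_r)^2$; $\tilde{\mathbf{C}}=\mathrm{diag}(\tilde C_{11},0,0)$, $\tilde C_{11}=IA^2(\sin\delta_f-\sin\delta_r)(\cos\delta_f\,\dot\delta_f-\cos\delta_r\,\dot\delta_r)-\frac m4\sin(\delta_f-\delta_r)(\dot\delta_f-\dot\delta_r)$; $\tilde{\mathbf{B}}=\mathrm{diag}(\tilde B_{11},2,2)$, $\tilde B_{11}=\frac1r\big[2(1+\cos(\delta_f-\delta_r))+\frac{a^2}{a^2+b^2}(\sin\delta_f-\sin\delta_r)^2+4\big]$ (invertible); $\tilde{\mathbf{f}}(\mathbf{q},\mathbf{v})=\mathbf{J}^{\mathrm T}(\mathbf{q})\mathbf{f}(\mathbf{q},\mathbf{J}(\mathbf{q})\mathbf{v})$. Uncertainty. $\mathbf{f}=[f_x\ f_y\ f_\theta\ f_\varphi\ f_{\delta_f}\ f_{\delta_r}]^{\mathrm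 T}:\mathbb{R}^6\times\mathbb{R}^6\to\mathbb{R}^6$ is $C^1$ on an open set containing $\mathcal X\times\mathcal D$, with $\mathcal X,\mathcal D\subset\mathbb{R}^6$ compact. Each $f_k$, $k\in\{x,y,\theta,\varphi,\delta_f,\delta_r\}$, depends on $\dot{\mathbf{q}}$ only through $\dot k$ and satisfies $|f_k(\mathbf{q},\dot{\mathbf{q}})|\le g_k(\mathbf{q})+h_k(\mathbf{q})|\dot k|$ with nonnegative $g_k,h_k$. Put $c_k=\sup_{\mathbf{q}\in\mathcal X}g_k(\mathbf{q})$, $d_k=\sup_{\mathbf{q}\in\mathcal X}h_k(\mathbf{q})$, and let $\mathbf{c},\mathbf{d}\in\mathbb{R}^6$ be the vectors of the $c_k$ and $d_k$ for $k\in\{x,y,\theta,\varphi,\delta_f,\delta_r\}$ (not to be confused with the scalars $c_1,\dots,c_4$), so that $\|\mathbf{f}\|\le\|\mathbf{c}\|+\|\mathbf{d}\|\|\dot{\mathbf{q}}\|$. Let $L_{f_2}=\sup_{\mathcal X\times\mathcal D}\|\partial\mathbf{f}/\partial\dot{\mathbf{q}}\|<\infty$. Virtual kinematic controller (outer loop). For a reference pose $x_d(t),y_d(t),\theta_d(t)$ with $\omega_d=\dot\theta_d$, let $e_x=(x_d-x)\cos\theta+(y_d-y)\sin\theta$, $e_y=-(x_d-x)\sin\theta+(y_d-y)\cos\theta$, $e_\theta=\theta_d-\theta$, and, with gains $k_x,k_y,k_\theta,k_\delta>0$, $u_x=\dot x_d\cos\theta+\dot y_d\sin\theta+k_xe_x$,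 $u_y=-\dot x_d\sin\theta+\dot y_d\cos\theta+k_ye_y$, $\omega_{virt}=\omega_d+k_\theta e_\theta$. Put $v_t=\sqrt{u_x^2+u_y^2}$, $\beta_d=\operatorname{atan2}(u_y,u_x)$, $\gamma_d=\operatorname{atan2}(\omega_{virt},2Av_t\cos\beta_d)$ (regularized and saturated so that $|\gamma_d|\le\gamma_{\max}<\pi/2$), $v_{w,d}=v_t/\cos\gamma_d$, $\delta_{f,d}=\beta_d+\gamma_d$, $\delta_{r,d}=\beta_d-\gamma_d$ (saturated to $|\delta_{(\cdot),d}|\le\delta_{\max}$), $\omega_{f,d}=\dot\delta_{f,d}-k_\delta(\delta_f-\delta_{f,d})$, $\omega_{r,d}=\dot\delta_{r,d}-k_\delta(\delta_r-\delta_{r,d})$ (with $|\omega_{(\cdot),d}|\le\dot\delta_{\max}$). The generated reference velocity is $\mathbf{v}_d=[v_{w,d}\ \omega_{f,d}\ \omega_{r,d}]^{\mathrm T}$, with associated desired configuration $\mathbf{q}_d(t)$, $\dot{\mathbf{q}}_d=\mathbf{J}(\mathbf{q}_d)\mathbf{v}_d$, and $V_d=\sup_t\|\mathbf{v}_d(t)\|<\infty$, $A_d=\sup_t\|\dot{\mathbf{v}}_d(t)\|<\infty$. Inner-loop controller. With $\mathbf{e}_v=\mathbf{v}-\mathbf{v}_d$, $$\boldsymbol\tau=\tilde{\mathbf{B}}^{-1}(\mathbf{q})\big(-\mathbf{K}_P\mathbf{e}_v-\mathbf{K}_I\boldsymbol\eta+\tilde{\mathbf{M}}(\mathbf{q}_d)\dot{\mathbf{v}}_d+\tilde{\mathbf{C}}(\mathbf{q}_d,\dot{\mathbf{q}}_d)\mathbf{v}_d\big),\qquad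 \dot{\boldsymbol\eta}=\mathbf{e}_v,$$ where $\mathbf{K}_P,\mathbf{K}_I\in\mathbb{R}^{3\times3}$ are diagonal positive definite. ''Closed-loop trajectories'' are solutions of this feedback system staying in the operating set: $\mathbf{q}\in\mathcal X$, $\dot{\mathbf{q}}\in\mathcal D$ (and likewise for the desired motion), with $\delta_f,\delta_r\in\mathcal D_\delta$ (set of admissible steering angles) and $|\dot\delta_f|,|\dot\delta_r|\le\dot\delta_{\max}$. Constants. $a_1=\min\{4I_\varphi/r^2,\,2I_\delta\}$, $a_2=\max\{4I_\varphi/r^2+m+4IA^2,\,2I_\delta\}$ (uniform lower and upper bounds of the eigenvalues of $\tilde{\mathbf{M}}(\mathbf{q})$). $c_c=(4IA^2+\frac m2)\dot\delta_{\max}$ (uniform bound of $\|\tilde{\mathbf{C}}\|$). With $\mathbf{W}_0=\mathrm{diag}(1,1,1,r^2,1,1)$, $\|\dot{\mathbf{q}}\|_{W}=\sqrt{\dot{\mathbf{q}}^{\mathrm T}\mathbf{W}_0\dot{\mathbf{q}}}$ and $\|\mathbf{J}\|_W=\sup_{\mathbf{v}\ne0}\|\mathbf{J}\mathbf{v}\|_W/\|\mathbf{v}\|$, let $\sigma_J=\sup_{\mathbf{q}\in\mathcal X}\|\mathbf{J}(\mathbf{q})\|_W$, bounded by $\sqrt{2+4A^2}$. $\sigma_{\partial J}=\sup\|\partial\mathbf{J}/\partial\mathbf{q}\|$ (norm of the Fréchet derivative of $\mathbf{J}$), bounded by $\sqrt{3/2+2A^2}$. $\tilde c=\sigma_J\|\mathbf{c}\|$,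 $\tilde d=\sigma_J^2\|\mathbf{d}\|$. $L_M=\sup\|[\partial\tilde M_{11}/\partial\delta_f\ \ \partial\tilde M_{11}/\partial\delta_r]\|\le\sqrt2(\frac m2+4IA^2)$, $L_{C_1}=\sup\|[\partial\tilde C_{11}/\partial\delta_f\ \ \partial\tilde C_{11}/\partial\delta_r]\|\le\sqrt2(\frac m4+4IA^2)\dot\delta_{\max}$, $L_{C_2}=\sup\|[\partial\tilde C_{11}/\partial\dot\delta_f\ \ \partial\tilde C_{11}/\partial\dot\delta_r]\|\le\sqrt2(\frac m4+2IA^2)$, suprema over $\delta_f,\delta_r\in\mathcal D_\delta$, $|\dot\delta_f|,|\dot\delta_r|\le\dot\delta_{\max}$ (Lipschitz constants of $\tilde{\mathbf{M}}$ in $\mathbf{q}$, and of $\tilde{\mathbf{C}}$ in $\mathbf{q}$ and $\dot{\mathbf{q}}$). $d_v>0$ is a constant with $\|\tilde{\mathbf{f}}(\mathbf{q},\mathbf{v}_d)-\tilde{\mathbf{f}}(\mathbf{q},\mathbf{v})\|\le d_v\|\mathbf{v}-\mathbf{v}_d\|$, explicitly $d_v=\sup_{\mathcal X\times\mathcal D}\|\mathbf{J}^{\mathrm T}\frac{\partial\mathbf{f}}{\partial\dot{\mathbf{q}}}\mathbf{J}\|$, with conservative bound $\sigma_J^2L_{f_2}$. Finally $A_q=L_MA_d+L_{C_1}V_d+L_{C_2}\sigma_{\partial J}V_d^2$, $A_v=L_{C_2}\sigma_JV_d$, $A_c=\tilde c+\tilde dV_d$. Terminology. $\mathbf{z}$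 is uniformly ultimately bounded if there is $\beta>0$ such that for every $R>0$ there is $T(R)\ge0$ with $\|\mathbf{z}(t)\|\le\beta$ for all $t\ge T(R)$ whenever $\|\mathbf{z}(0)\|\le R$. Exponential stability of $\mathbf{z}=0$ on the operating set means $\|\mathbf{z}(t)\|\le ke^{-\lambda t}\|\mathbf{z}(0)\|$ for all $t\ge0$ with some $k,\lambda>0$.
   Formalization: The explicit choice of constants is shown only if r ≥ 1 or if ‖f̃(q,v_d)‖ ≤ c̃ + d̃‖v_d‖ along closed-loop trajectories (with the literal norms it fails for small r); c_3, c_4 may be zero, as c_4 = 0 when A_c = 0. *)

(* Defs.v *)
From mathcomp Require Import all_boot all_order all_algebra.
From mathcomp Require Import all_classical all_reals all_analysis.

Set Implicit Arguments.
Unset Strict Implicit.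
Unset Printing Implicit Defensive.

Import Order.TTheory GRing.Theory Num.Theory.
Import numFieldNormedType.Exports.

Local Open Scope classical_set_scope.
Local Open Scope ring_scope.

(* The library norm on matrices is the max norm, hence the explicit
   Euclidean norm. *)
Definition norm2 (R : realType) (n : nat) (x : 'cV[R]_n) : R :=
  Num.sqrt (\sum_i x i 0 ^+ 2).

Definition opnorm (R : realType) (U V : zmodType) (nU : U -> R) (nV : V -> R)
    (A : U -> V) : R :=
  sup [set nV (A x) / nU x | x in [set x | x != 0]].

Definition mxnorm2 (R : realType) (m n : nat) (A : 'M[R]_(m, n)) : R :=
  opnorm (@norm2 R n) (@norm2 R m) (mulmx A).

(* Used for symmetric matrices only. *)
Definition lambda_min (R : realType) (n : nat) (K : 'M[R]_n) : R :=
  inf [set l | eigenvalue K l].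
Definition lambda_max (R : realType) (n : nat) (K : 'M[R]_n) : R :=
  sup [set l | eigenvalue K l].

Definition diag_posdef (R : realType) (n : nat) (K : 'M[R]_n) : Prop :=
  is_diag_mx K /\ forall x : 'cV[R]_n, x != 0 -> 0 < (x^T *m K *m x) 0 0.

Definition atan2 (R : realType) (y x : R) : R :=
  if 0 < x then atan (y / x)
  else if x < 0 then (if 0 <= y then atan (y / x) + pi else atan (y / x) - pi)
  else if 0 < y then pi / 2 else if y < 0 then - (pi / 2) else 0.

(* Configurations are [x; y; theta; phi; delta_f; delta_r] and reduced
   velocities are [v_w; omega_f; omega_r]. *)
Definition ix_x : 'I_6 := @Ordinal 6 0 isT.
Definition ix_y : 'I_6 := @Ordinal 6 1 isT.
Definition ix_th : 'I_6 := @Ordinal 6 2 isT.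
Definition ix_phi : 'I_6 := @Ordinal 6 3 isT.
Definition ix_df : 'I_6 := @Ordinal 6 4 isT.
Definition ix_dr : 'I_6 := @Ordinal 6 5 isT.
Definition iv_f : 'I_3 := @Ordinal 3 1 isT.
Definition iv_r : 'I_3 := @Ordinal 3 2 isT.

Definition col_of (R : realType) (n : nat) (s : seq R) : 'cV[R]_n :=
  \col_i s`_i.
Definition diag_of (R : realType) (n : nat) (s : seq R) : 'M[R]_n :=
  diag_mx (\row_i s`_i).

Record robot (R : realType) := Robot {
  rb_m : R; rb_I : R; rb_Iphi : R; rb_Idelta : R;
  rb_r : R; rb_a : R; rb_b : R }.

Definition robot_pos (R : realType) (p : robot R) : Prop :=
  [/\ 0 < rb_m p, 0 < rb_I p, 0 < rb_Iphi p & 0 < rb_Idelta p] /\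
  [/\ 0 < rb_r p, 0 < rb_a p & 0 < rb_b p].

Definition rb_A (R : realType) (p : robot R) : R :=
  rb_a p / (2 * (rb_a p ^+ 2 + rb_b p ^+ 2)).

Definition Jmx (R : realType) (p : robot R) (q : 'cV[R]_6) : 'M[R]_(6, 3) :=
  let th := q ix_th 0 in let df := q ix_df 0 in let dr := q ix_dr 0 in
  \matrix_(i, j)
    if j == iv_f then (i == ix_df)%:R
    else if j == iv_r then (i == ix_dr)%:R
    else (col_of 6 [:: (cos (df + th) + cos (dr + th)) / 2;
                       (sin (df + th) + sin (dr + th)) / 2;
                       rb_A p * (sin df - sin dr);
                       (rb_r p)^-1; 0; 0]) i 0.

Definition M11 (R : realType) (p : robot R) (df dr : R) : R :=
  4 * rb_Iphi p / rb_r p ^+ 2 + rb_m p / 2 * (1 + cos (df - dr))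
  + rb_I p * rb_A p ^+ 2 * (sin df - sin dr) ^+ 2.

Definition C11 (R : realType) (p : robot R) (df dr wf wr : R) : R :=
  rb_I p * rb_A p ^+ 2 * (sin df - sin dr) * (cos df * wf - cos dr * wr)
  - rb_m p / 4 * sin (df - dr) * (wf - wr).

Definition B11 (R : realType) (p : robot R) (df dr : R) : R :=
  (rb_r p)^-1 * (2 * (1 + cos (df - dr))
    + rb_a p ^+ 2 / (rb_a p ^+ 2 + rb_b p ^+ 2) * (sin df - sin dr) ^+ 2 + 4).

Definition Mt (R : realType) (p : robot R) (q : 'cV[R]_6) : 'M[R]_3 :=
  diag_of 3 [:: M11 p (q ix_df 0) (q ix_dr 0); 2 * rb_Idelta p;
                2 * rb_Idelta p].

Definition Ct (R : realType) (p : robot R) (q qdot : 'cV[R]_6) : 'M[R]_3 :=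
  diag_of 3 [:: C11 p (q ix_df 0) (q ix_dr 0) (qdot ix_df 0) (qdot ix_dr 0);
                0; 0].

Definition Bt (R : realType) (p : robot R) (q : 'cV[R]_6) : 'M[R]_3 :=
  diag_of 3 [:: B11 p (q ix_df 0) (q ix_dr 0); 2; 2].

(* Reference pose and virtual kinematic controller.  [ol_gamma y x] is the
   regularized and saturated version of [atan2 y x] that produces gamma_d, and
   [ol_sat] is the saturation that produces delta_{f,d} and delta_{r,d}. *)
Record outer_loop (R : realType) := OuterLoop {
  ol_xd : R -> R; ol_yd : R -> R; ol_thd : R -> R;
  ol_kx : R; ol_ky : R; ol_kth : R; ol_kdelta : R;
  ol_gamma_max : R; ol_delta_max : R;
  ol_gamma : R -> R -> R; ol_sat : R -> R }.

Record system (R : realType) := System {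
  sy_rb : robot R;
  sy_ol : outer_loop R;
  sy_f : 'cV[R]_6 -> 'cV[R]_6 -> 'cV[R]_6;
  sy_g : 'cV[R]_6 -> 'cV[R]_6;
  sy_h : 'cV[R]_6 -> 'cV[R]_6;
  sy_X : set 'cV[R]_6;
  sy_D : set 'cV[R]_6;
  sy_Ddelta : set R;
  sy_ddmax : R;
  sy_KP : 'M[R]_3;
  sy_KI : 'M[R]_3 }.

(* A saturation is the identity near 0 and bounded by [bnd]; both the hard
   clamp and its smoothings are instances. *)
Definition is_saturation (R : realType) (bnd : R) (s : R -> R) : Prop :=
  (forall x, `|s x| <= bnd) /\
  exists lo, [/\ 0 < lo, lo <= bnd & forall x, `|x| <= lo -> s x = x].

(* Coincides with atan2 away from the singularity (y, x) = (0, 0) as long as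
   the saturation is not active. *)
Definition is_regularized_atan2 (R : realType) (bnd : R) (s : R -> R -> R) :
    Prop :=
  (forall y x, `|s y x| <= bnd) /\
  exists eps lo, [/\ 0 < eps, 0 < lo, lo <= bnd &
    forall y x, eps <= Num.sqrt (x ^+ 2 + y ^+ 2) -> `|atan2 y x| <= lo ->
      s y x = atan2 y x].

Definition outer_loop_ok (R : realType) (o : outer_loop R) : Prop :=
  [/\ [/\ 0 < ol_kx o, 0 < ol_ky o, 0 < ol_kth o & 0 < ol_kdelta o],
      [/\ ol_gamma_max o < pi / 2, 0 < ol_delta_max o,
          is_regularized_atan2 (ol_gamma_max o) (ol_gamma o) &
          is_saturation (ol_delta_max o) (ol_sat o)] &
      forall t : R, 0 < t -> [/\ derivable (ol_xd o) t 1,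
        derivable (ol_yd o) t 1 & derivable (ol_thd o) t 1]].

Definition C1_on (R : realType) (f : 'cV[R]_6 -> 'cV[R]_6 -> 'cV[R]_6)
    (U : set ('cV[R]_6 * 'cV[R]_6)) : Prop :=
  let F := fun z : 'cV[R]_6 * 'cV[R]_6 => f z.1 z.2 in
  (forall z, U z -> differentiable F z) /\
  (forall (w : 'cV[R]_6 * 'cV[R]_6) z, U z ->
     {for z, continuous (fun y => 'd F y w)}).

Definition uncertainty_ok (R : realType) (S : system R) : Prop :=
  [/\ compact (sy_X S),
      compact (sy_D S),
      exists U, [/\ open U, sy_X S `*` sy_D S `<=` U & C1_on (sy_f S) U],
      forall k (q p p' : 'cV[R]_6),
        p k 0 = p' k 0 -> sy_f S q p k 0 = sy_f S q p' k 0 &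
      [/\ forall k q, 0 <= sy_g S q k 0 /\ 0 <= sy_h S q k 0,
          forall k (q p : 'cV[R]_6),
            `|sy_f S q p k 0| <= sy_g S q k 0 + sy_h S q k 0 * `|p k 0| &
          forall k, has_ubound [set sy_g S q k 0 | q in sy_X S] /\
                    has_ubound [set sy_h S q k 0 | q in sy_X S]]].

(* [sy_Ddelta] is an interval, so that the suprema of gradients over it are
   Lipschitz constants. *)
Definition system_ok (R : realType) (S : system R) : Prop :=
  [/\ robot_pos (sy_rb S), outer_loop_ok (sy_ol S), uncertainty_ok S,
      is_interval (sy_Ddelta S) /\ 0 < sy_ddmax S &
      diag_posdef (sy_KP S) /\ diag_posdef (sy_KI S)].

Definition ol_ux (R : realType) (o : outer_loop R) (t : R) (q : 'cV[R]_6) : R :=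
  let th := q ix_th 0 in
  let ex := (ol_xd o t - q ix_x 0) * cos th + (ol_yd o t - q ix_y 0) * sin th in
  derive1 (ol_xd o) t * cos th + derive1 (ol_yd o) t * sin th + ol_kx o * ex.

Definition ol_uy (R : realType) (o : outer_loop R) (t : R) (q : 'cV[R]_6) : R :=
  let th := q ix_th 0 in
  let ey := - (ol_xd o t - q ix_x 0) * sin th
            + (ol_yd o t - q ix_y 0) * cos th in
  - derive1 (ol_xd o) t * sin th + derive1 (ol_yd o) t * cos th + ol_ky o * ey.

Definition ol_wvirt (R : realType) (o : outer_loop R) (t : R) (q : 'cV[R]_6) :
    R :=
  derive1 (ol_thd o) t + ol_kth o * (ol_thd o t - q ix_th 0).

Definition ol_vt (R : realType) (o : outer_loop R) (t : R) (q : 'cV[R]_6) : R :=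
  Num.sqrt (ol_ux o t q ^+ 2 + ol_uy o t q ^+ 2).

Definition beta_d (R : realType) (o : outer_loop R) (t : R) (q : 'cV[R]_6) : R :=
  atan2 (ol_uy o t q) (ol_ux o t q).

Definition gamma_d (R : realType) (p : robot R) (o : outer_loop R) (t : R)
    (q : 'cV[R]_6) : R :=
  ol_gamma o (ol_wvirt o t q) (2 * rb_A p * ol_vt o t q * cos (beta_d o t q)).

Definition vw_d (R : realType) (p : robot R) (o : outer_loop R) (t : R)
    (q : 'cV[R]_6) : R :=
  ol_vt o t q / cos (gamma_d p o t q).

Definition delta_fd (R : realType) (p : robot R) (o : outer_loop R) (t : R)
    (q : 'cV[R]_6) : R :=
  ol_sat o (beta_d o t q + gamma_d p o t q).

Definition delta_rd (R : realType) (p : robot R) (o : outer_loop R) (t : R)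
    (q : 'cV[R]_6) : R :=
  ol_sat o (beta_d o t q - gamma_d p o t q).

Record trajectory (R : realType) := Trajectory {
  tr_q : R -> 'cV[R]_6;
  tr_v : R -> 'cV[R]_3;
  tr_eta : R -> 'cV[R]_3;
  tr_qd : R -> 'cV[R]_6;
  tr_vd : R -> 'cV[R]_3 }.

Definition tr_e (R : realType) (tr : trajectory R) (t : R) : 'cV[R]_3 :=
  tr_v tr t - tr_vd tr t.
Definition tr_z (R : realType) (tr : trajectory R) (t : R) : 'cV[R]_(3 + 3) :=
  col_mx (tr_e tr t) (tr_eta tr t).

(* delta_{f,d} and delta_{r,d} are differentiated in time along the
   trajectory. *)
Definition virtual_controller (R : realType) (p : robot R) (o : outer_loop R)
    (q : R -> 'cV[R]_6) (vd : R -> 'cV[R]_3) : Prop :=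
  let dfd := fun t => delta_fd p o t (q t) in
  let drd := fun t => delta_rd p o t (q t) in
  forall t : R, 0 < t ->
    [/\ derivable dfd t 1, derivable drd t 1 &
        vd t = col_of 3
          [:: vw_d p o t (q t);
              derive1 dfd t - ol_kdelta o * (q t ix_df 0 - dfd t);
              derive1 drd t - ol_kdelta o * (q t ix_dr 0 - drd t)]].

Definition ftilde (R : realType) (S : system R) (q : 'cV[R]_6) (v : 'cV[R]_3) :
    'cV[R]_3 :=
  (Jmx (sy_rb S) q)^T *m sy_f S q (Jmx (sy_rb S) q *m v).

Definition torque (R : realType) (S : system R) (q : 'cV[R]_6)
    (e eta : 'cV[R]_3) (qd : 'cV[R]_6) (vd dvd : 'cV[R]_3) : 'cV[R]_3 :=
  let p := sy_rb S in
  invmx (Bt p q) *m (- (sy_KP S *m e) - sy_KI S *m eta + Mt p qd *m dvd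
                     + Ct p qd (Jmx p qd *m vd) *m vd).

Definition in_operating_set (R : realType) (S : system R) (q : 'cV[R]_6)
    (v : 'cV[R]_3) : Prop :=
  [/\ sy_X S q, sy_D S (Jmx (sy_rb S) q *m v),
      sy_Ddelta S (q ix_df 0) /\ sy_Ddelta S (q ix_dr 0) &
      `|v iv_f 0| <= sy_ddmax S /\ `|v iv_r 0| <= sy_ddmax S].

(* Solutions on [0, +oo[: continuous there, with the differential equations
   holding on ]0, +oo[.  Values at negative times are irrelevant. *)
Record closed_loop (R : realType) (S : system R) (tr : trajectory R) : Prop :=
  ClosedLoop {
  cl_cont : [/\ {within [set t : R | 0 <= t], continuous (tr_q tr)},
                {within [set t : R | 0 <= t], continuous (tr_v tr)},
                {within [set t : R | 0 <= t], continuous (tr_eta tr)},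
                {within [set t : R | 0 <= t], continuous (tr_qd tr)} &
                {within [set t : R | 0 <= t], continuous (tr_vd tr)}];
  cl_q : forall t : R, 0 < t ->
    is_derive t 1 (tr_q tr) (Jmx (sy_rb S) (tr_q tr t) *m tr_v tr t);
  cl_v : forall t : R, 0 < t -> derivable (tr_v tr) t 1 /\
    let q := tr_q tr t in let v := tr_v tr t in
    Mt (sy_rb S) q *m derive1 (tr_v tr) t
      + Ct (sy_rb S) q (Jmx (sy_rb S) q *m v) *m v
    = Bt (sy_rb S) q *m torque S q (tr_e tr t) (tr_eta tr t)
                          (tr_qd tr t) (tr_vd tr t) (derive1 (tr_vd tr) t)
      - ftilde S q v;
  cl_eta : forall t : R, 0 < t -> is_derive t 1 (tr_eta tr) (tr_e tr t);
  cl_qd : forall t : R, 0 < t ->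
    is_derive t 1 (tr_qd tr) (Jmx (sy_rb S) (tr_qd tr t) *m tr_vd tr t);
  cl_vd : forall t : R, 0 < t -> derivable (tr_vd tr) t 1;
  cl_virt : virtual_controller (sy_rb S) (sy_ol S) (tr_q tr) (tr_vd tr);
  cl_op : forall t : R, 0 <= t -> in_operating_set S (tr_q tr t) (tr_v tr t);
  cl_opd : forall t : R, 0 <= t -> in_operating_set S (tr_qd tr t) (tr_vd tr t) }.

(* The reference velocity is generated by feedback from q, so the suprema over
   time are also taken over the closed-loop trajectories. *)
Definition vd_norms (R : realType) (S : system R) : set R :=
  [set x | exists tr t,
     [/\ closed_loop S tr, 0 <= t & x = norm2 (tr_vd tr t)]].
Definition dvd_norms (R : realType) (S : system R) : set R :=
  [set x | exists tr t,
     [/\ closed_loop S tr, 0 < t & x = norm2 (derive1 (tr_vd tr) t)]].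

Definition V_d (R : realType) (S : system R) : R := sup (vd_norms S).
Definition A_d (R : realType) (S : system R) : R := sup (dvd_norms S).

Definition references_bounded (R : realType) (S : system R) : Prop :=
  has_ubound (vd_norms S) /\ has_ubound (dvd_norms S).

Definition const_a1 (R : realType) (S : system R) : R :=
  let p := sy_rb S in
  Num.min (4 * rb_Iphi p / rb_r p ^+ 2) (2 * rb_Idelta p).

Definition const_a2 (R : realType) (S : system R) : R :=
  let p := sy_rb S in
  Num.max (4 * rb_Iphi p / rb_r p ^+ 2 + rb_m p + 4 * rb_I p * rb_A p ^+ 2)
          (2 * rb_Idelta p).

Definition const_cc (R : realType) (S : system R) : R :=
  let p := sy_rb S in
  (4 * rb_I p * rb_A p ^+ 2 + rb_m p / 2) * sy_ddmax S.

Definition normW (R : realType) (p : robot R) (x : 'cV[R]_6) : R :=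
  Num.sqrt ((x^T *m diag_of 6 [:: 1; 1; 1; rb_r p ^+ 2; 1; 1] *m x) 0 0).

Definition sigma_J (R : realType) (S : system R) : R :=
  sup [set opnorm (@norm2 R 3) (normW (sy_rb S)) (mulmx (Jmx (sy_rb S) q))
      | q in sy_X S].

Definition sigma_dJ (R : realType) (S : system R) : R :=
  sup [set opnorm (@norm2 R 6) (@mxnorm2 R 6 3) ('d (Jmx (sy_rb S)) q)
      | q in sy_X S].

Definition c_vec (R : realType) (S : system R) : 'cV[R]_6 :=
  \col_k sup [set sy_g S q k 0 | q in sy_X S].
Definition d_vec (R : realType) (S : system R) : 'cV[R]_6 :=
  \col_k sup [set sy_h S q k 0 | q in sy_X S].

Definition c_tilde (R : realType) (S : system R) : R :=
  sigma_J S * norm2 (c_vec S).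
Definition d_tilde (R : realType) (S : system R) : R :=
  sigma_J S ^+ 2 * norm2 (d_vec S).

Definition const_LM (R : realType) (S : system R) : R :=
  let p := sy_rb S in
  sup [set l | exists df dr, [/\ sy_Ddelta S df, sy_Ddelta S dr &
    l = norm2 (col_of 2 [:: derive1 (fun x => M11 p x dr) df;
                            derive1 (fun x => M11 p df x) dr])]].

Definition const_LC1 (R : realType) (S : system R) : R :=
  let p := sy_rb S in
  sup [set l | exists df dr wf wr,
    [/\ sy_Ddelta S df, sy_Ddelta S dr,
        `|wf| <= sy_ddmax S, `|wr| <= sy_ddmax S &
    l = norm2 (col_of 2 [:: derive1 (fun x => C11 p x dr wf wr) df;
                            derive1 (fun x => C11 p df x wf wr) dr])]].

Definition const_LC2 (R : realType) (S : system R) : R :=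
  let p := sy_rb S in
  sup [set l | exists df dr wf wr,
    [/\ sy_Ddelta S df, sy_Ddelta S dr,
        `|wf| <= sy_ddmax S, `|wr| <= sy_ddmax S &
    l = norm2 (col_of 2 [:: derive1 (fun x => C11 p df dr x wr) wf;
                            derive1 (fun x => C11 p df dr wf x) wr])]].

Definition df_dqdot (R : realType) (S : system R) (q qdot : 'cV[R]_6) :
    'M[R]_6 :=
  \matrix_(i, j) 'D_(delta_mx j 0) (fun x : 'cV[R]_6 => sy_f S q x i 0) qdot.

Definition const_dv (R : realType) (S : system R) : R :=
  sup [set l | exists q qdot, [/\ sy_X S q, sy_D S qdot &
    l = mxnorm2 ((Jmx (sy_rb S) q)^T *m df_dqdot S q qdot
                 *m Jmx (sy_rb S) q)]].

(* The defining property of d_v, required at the values it is applied to. *)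
Definition dv_property (R : realType) (S : system R) : Prop :=
  0 < const_dv S /\
  forall tr (t : R), closed_loop S tr -> 0 <= t ->
    norm2 (ftilde S (tr_q tr t) (tr_vd tr t) - ftilde S (tr_q tr t) (tr_v tr t))
    <= const_dv S * norm2 (tr_v tr t - tr_vd tr t).

Definition A_q (R : realType) (S : system R) : R :=
  const_LM S * A_d S + const_LC1 S * V_d S
  + const_LC2 S * sigma_dJ S * V_d S ^+ 2.
Definition A_v (R : realType) (S : system R) : R :=
  const_LC2 S * sigma_J S * V_d S.
Definition A_c (R : realType) (S : system R) : R :=
  c_tilde S + d_tilde S * V_d S.

(* The estimate of the uncertainty from which A_c originates.  It follows from
   the bounds on f when 1 <= rb_r; when rb_r < 1 the weighted norm in sigma_J
   does not dominate the Euclidean norm of J, and it is a genuine restriction. *)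
Definition ftilde_estimate (R : realType) (S : system R) : Prop :=
  forall tr (t : R), closed_loop S tr -> 0 <= t ->
    norm2 (ftilde S (tr_q tr t) (tr_vd tr t))
    <= c_tilde S + d_tilde S * norm2 (tr_vd tr t).

Definition mu0 (R : realType) (S : system R) : R :=
  lambda_min (sy_KP S) - A_v S - const_dv S.
Definition chi (R : realType) (S : system R) : R :=
  const_cc S + lambda_max (sy_KP S) + const_dv S + A_v S.

Definition Wfun (R : realType) (S : system R) (delta : R) (q : 'cV[R]_6)
    (e eta : 'cV[R]_3) : R :=
  (e^T *m Mt (sy_rb S) q *m e) 0 0 / 2 + (eta^T *m sy_KI S *m eta) 0 0 / 2
  + delta * (e^T *m Mt (sy_rb S) q *m eta) 0 0.

Definition Wtr (R : realType) (S : system R) (delta : R) (tr : trajectory R)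
    (t : R) : R :=
  Wfun S delta (tr_q tr t) (tr_e tr t) (tr_eta tr t).

Record constants (R : realType) := Constants {
  k_lo : R; k_up : R; k_1 : R; k_2 : R; k_3 : R; k_4 : R }.

Definition constants_pos (R : realType) (k : constants R) : Prop :=
  [/\ 0 < k_lo k, 0 < k_up k, 0 < k_1 k & 0 < k_2 k] /\
  0 < k_3 k /\ 0 < k_4 k.

(* k_3 and k_4 may vanish: the explicit k_4 does when A_c = 0. *)
Definition lyapunov_constants (R : realType) (S : system R) (delta : R)
    (k : constants R) : Prop :=
  [/\ [/\ 0 < k_lo k, 0 < k_up k, 0 < k_1 k & 0 < k_2 k],
      0 <= k_3 k /\ 0 <= k_4 k,
      forall q (e eta : 'cV[R]_3),
        sy_X S q -> sy_Ddelta S (q ix_df 0) -> sy_Ddelta S (q ix_dr 0) ->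
        k_lo k * norm2 (col_mx e eta) ^+ 2 <= Wfun S delta q e eta /\
        Wfun S delta q e eta <= k_up k * norm2 (col_mx e eta) ^+ 2 &
      forall tr (t : R), closed_loop S tr -> 0 < t ->
        derive1 (Wtr S delta tr) t
        <= - k_1 k * norm2 (tr_e tr t) ^+ 2 - k_2 k * norm2 (tr_eta tr t) ^+ 2
           + k_3 k * norm2 (tr_q tr t - tr_qd tr t) ^+ 2 + k_4 k].

Definition explicit_constants (R : realType) (S : system R) (delta : R) :
    constants R :=
  let a1 := const_a1 S in let a2 := const_a2 S in
  let lI := lambda_min (sy_KI S) in let LI := lambda_max (sy_KI S) in
  Constants
    (Num.min (a1 - delta * a2) (lI - delta * a2) / 2)
    (Num.max (a2 + delta * a2) (LI + delta * a2) / 2)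
    (mu0 S / 2 - delta * (a2 + chi S ^+ 2 / lI))
    (delta / 4 * lI)
    (A_q S ^+ 2 / mu0 S + delta * (A_q S ^+ 2 / lI))
    (A_c S ^+ 2 / mu0 S + delta * (A_c S ^+ 2 / lI)).

Definition error_bounded (R : realType) (S : system R) (qbar : R) :
    set (trajectory R) :=
  [set tr | closed_loop S tr /\
     forall t : R, 0 <= t -> norm2 (tr_q tr t - tr_qd tr t) <= qbar].

Definition nominal (R : realType) (S : system R) : set (trajectory R) :=
  [set tr | closed_loop S tr /\ forall t : R, 0 <= t -> tr_q tr t = tr_qd tr t].

Definition uniformly_ultimately_bounded (R : realType)
    (F : set (trajectory R)) : Prop :=
  exists2 beta : R, 0 < beta & forall rad : R, 0 < rad ->
    exists2 T : R, 0 <= T & forall tr, F tr -> norm2 (tr_z tr 0) <= rad ->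
      forall t, T <= t -> norm2 (tr_z tr t) <= beta.

Definition exponentially_stable (R : realType) (F : set (trajectory R)) :
    Prop :=
  exists k lam : R, [/\ 0 < k, 0 < lam & forall tr, F tr ->
    forall t : R, 0 <= t ->
      norm2 (tr_z tr t) <= k * expR (- lam * t) * norm2 (tr_z tr 0)].

(* Main.v *)
Require Import Defs.
From mathcomp Require Import all_boot all_order all_algebra.
From mathcomp Require Import all_classical all_reals all_analysis.
From mathcomp Require Import ring lra.

(** The error dynamics read M(q) e' = - C(q, q') e - K_P e - K_I eta + r, where
    the residual r collects the mismatch of M and C between q and q_d and the
    uncertainty.  As M' = 2 C, the quadratic terms in C cancel in the derivative
    of W, as do the cross terms e^T K_I eta; the weight delta of the cross term
    e^T M eta produces the damping - delta eta^T K_I eta.  Lipschitz bounds give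
    |r| <= A_q |q - q_d| + A_c + (A_v + d_v) |e|, and Young's inequality absorbs
    the remaining products.  The bounds on W and z follow by Gronwall's lemma.

    The rate errors of the steering angles are components of e, so the mismatch
    of C in the rates is at most L_C2 |e| |v_d|; neither the Frechet derivative of
    J nor any property of sigma_J beyond 1 <= sigma_J is needed for A_q and A_v. *)

Set Implicit Arguments.
Unset Strict Implicit.
Unset Printing Implicit Defensive.

Import Order.TTheory GRing.Theory Num.Theory.
Import numFieldNormedType.Exports.
Local Open Scope classical_set_scope.
Local Open Scope ring_scope.

(** * Euclidean norm and diagonal matrices *)

(** The weighted norm behind [sigma_J] rescales the wheel entry [1/r] of J to 1, so for [rb_r < 1]
    it need not dominate the Euclidean norm of J, whereas the uncertainty enters as [J^T f(q, J v)]
    and is measured in the Euclidean norm. The derivative estimate is therefore proved for an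
    arbitrary bound [Ac] of the uncertainty at [v_d]. It is used with [Ac = A_c S] when
    [ftilde_estimate] is available, in particular for [1 <= rb_r], and with the Euclidean bound
    [Jbound] when only the existence of constants is claimed. The inertia, Coriolis and gain
    matrices are diagonal, so W and its derivative are sums over three coordinates and the algebra
    is scalar. The differential equations hold on []0, +oo[] only; continuity at 0 brings the
    initial value into the comparison argument. *)

Section norm2_theory.
Context {R : realType} {n : nat}.
Implicit Types x y : 'cV[R]_n.

Definition dot x y : R := \sum_i x i 0 * y i 0.

Lemma sum_sqr_ge0 x : 0 <= \sum_i x i 0 ^+ 2.
Proof. by apply: sumr_ge0 => i _; exact: sqr_ge0. Qed.

Lemma norm2_ge0 x : 0 <= norm2 x.
Proof. exact: sqrtr_ge0. Qed.

Lemma norm2_sqr x : norm2 x ^+ 2 = \sum_i x i 0 ^+ 2.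
Proof. by rewrite sqr_sqrtr// sum_sqr_ge0. Qed.

Lemma dotC x y : dot x y = dot y x.
Proof. by apply: eq_bigr => i _; rewrite mulrC. Qed.

Lemma dotxx x : dot x x = norm2 x ^+ 2.
Proof. by rewrite norm2_sqr. Qed.

Lemma norm2_eq0 x : norm2 x = 0 -> x = 0.
Proof.
move=> /eqP; rewrite -sqrf_eq0 norm2_sqr psumr_eq0 => [/allP h|i _]; last exact: sqr_ge0.
apply/matrixP => i j; rewrite ord1 mxE; apply/eqP; rewrite -sqrf_eq0.
exact: (h i (mem_index_enum i)).
Qed.

Lemma norm20 : norm2 (0 : 'cV[R]_n) = 0.
Proof. by rewrite /norm2 big1 ?sqrtr0// => i _; rewrite mxE expr0n. Qed.

Lemma norm2_gt0 x : x != 0 -> 0 < norm2 x.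
Proof.
move=> x0; rewrite lt_neqAle norm2_ge0 andbT eq_sym.
by apply: contra x0 => /eqP/norm2_eq0 ->.
Qed.

Lemma dot0l x : dot 0 x = 0.
Proof. by rewrite /dot big1// => i _; rewrite mxE mul0r. Qed.

(** Cauchy-Schwarz: for nonzero vectors, the nonnegative sum of the [(x_i |y| - y_i |x|)^2] expands
    to [2 |x| |y| (|x| |y| - x.y)]. *)
Lemma dot_le_norm2 x y : dot x y <= norm2 x * norm2 y.
Proof.
have [->|x0] := eqVneq x 0; first by rewrite dot0l norm20 mul0r.
have [->|y0] := eqVneq y 0; first by rewrite dotC dot0l norm20 mulr0.
have : 0 <= \sum_i (x i 0 * norm2 y - y i 0 * norm2 x) ^+ 2.
  by apply: sumr_ge0 => i _; exact: sqr_ge0.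
suff -> : \sum_i (x i 0 * norm2 y - y i 0 * norm2 x) ^+ 2 =
    2 * (norm2 x * norm2 y) * (norm2 x * norm2 y - dot x y).
  by rewrite pmulr_rge0 ?subr_ge0// !mulr_gt0// norm2_gt0.
transitivity (norm2 y ^+ 2 * \sum_i x i 0 ^+ 2 + norm2 x ^+ 2 * \sum_i y i 0 ^+ 2
   - 2 * norm2 x * norm2 y * dot x y).
  rewrite !mulr_sumr -sumrN -!big_split/=; apply: eq_bigr => i _; ring.
rewrite -!norm2_sqr; ring.
Qed.

Lemma norm2N x : norm2 (- x) = norm2 x.
Proof. by congr Num.sqrt; apply: eq_bigr => i _; rewrite mxE sqrrN. Qed.

Lemma norm2_triangle x y : norm2 (x + y) <= norm2 x + norm2 y.
Proof.
rewrite -(ler_pXn2r (n := 2))// ?nnegrE ?addr_ge0 ?norm2_ge0//.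
suff -> : norm2 (x + y) ^+ 2 = norm2 x ^+ 2 + 2 * dot x y + norm2 y ^+ 2.
  by have := dot_le_norm2 x y; lra.
rewrite !norm2_sqr /dot mulr_sumr -!big_split/=; apply: eq_bigr => i _.
rewrite mxE; ring.
Qed.

Lemma norm_coord_le x i : `|x i 0| <= norm2 x.
Proof.
rewrite -sqrtr_sqr ler_wsqrtr// (bigD1 i)//= lerDl.
by apply: sumr_ge0 => j _; exact: sqr_ge0.
Qed.

Lemma norm2_mono x y : (forall i, `|x i 0| <= `|y i 0|) -> norm2 x <= norm2 y.
Proof.
move=> h; rewrite ler_wsqrtr//; apply: ler_sum => i _.
by rewrite -(real_normK (num_real (x i 0))) -(real_normK (num_real (y i 0))) lerXn2r// nnegrE.
Qed.

Lemma norm2Z (a : R) x : norm2 (a *: x) = `|a| * norm2 x.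
Proof.
rewrite -sqrtr_sqr -sqrtrM ?sqr_ge0// mulr_sumr; congr Num.sqrt.
by apply: eq_bigr => i _; rewrite mxE exprMn.
Qed.

Lemma norm2_le_sqr x (a : R) : 0 <= a -> norm2 x ^+ 2 <= a ^+ 2 -> norm2 x <= a.
Proof. by move=> a0; rewrite ler_pXn2r// nnegrE norm2_ge0. Qed.

End norm2_theory.

Lemma norm2_col_mx (R : realType) (m n : nat) (x : 'cV[R]_m) (y : 'cV[R]_n) :
  norm2 (col_mx x y) ^+ 2 = norm2 x ^+ 2 + norm2 y ^+ 2.
Proof.
rewrite !norm2_sqr big_split_ord/=; congr (_ + _).
  by apply: eq_bigr => i _; rewrite col_mxEu.
by apply: eq_bigr => i _; rewrite col_mxEd.
Qed.

(** * Suprema under the default value 0 *)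

Section sup_ge0.
Context {R : realType}.

(** A set without a supremum has [sup] equal to 0, so the sign is known before any boundedness is
    established. *)
Lemma sup_nneg (A : set R) : (forall x, A x -> 0 <= x) -> 0 <= sup A.
Proof.
move=> A0; have [hA|hA] := pselect (has_sup A); last by rewrite sup_out.
by have [[x Ax] uA] := hA; exact: le_trans (A0 x Ax) (ub_le_sup uA Ax).
Qed.

Lemma opnorm_ge0 (U V : zmodType) (nU : U -> R) (nV : V -> R) (A : U -> V) :
  (forall x, 0 <= nU x) -> (forall x, 0 <= nV x) -> 0 <= opnorm nU nV A.
Proof. by move=> U0 V0; apply: sup_nneg => _ [x _ <-]; rewrite divr_ge0. Qed.

(** The assumption [0 <= b] covers the empty set, whose [sup] is 0. *)
Lemma ge_sup0 (A : set R) (b : R) : 0 <= b -> ubound A b -> sup A <= b.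
Proof.
move=> b0 ub; have [A0|/set0P] := eqVneq A set0.
  by rewrite A0 sup0.
by move=> A0; exact: ge_sup.
Qed.

End sup_ge0.

Section diagonal.
Context {R : realType} {n : nat}.
Variable K : 'M[R]_n.
Hypothesis Kpd : diag_posdef K.

Lemma diag_posdef_diag i : 0 < K i i.
Proof.
have := Kpd.2 (delta_mx i 0); rewrite trmx_delta -rowE -colE !mxE; apply.
apply/negP => /eqP /matrixP /(_ i 0); rewrite !mxE !eqxx/= => /eqP.
by rewrite oner_eq0.
Qed.

Lemma diag_posdef_off i j : i != j -> K i j = 0.
Proof. by move: i j; apply/is_diag_mxP; exact: Kpd.1. Qed.

(** At a coordinate where the left eigenvector does not vanish, the eigenvalue equation is scalar
    and that coordinate cancels. *)
Lemma diag_posdef_eigenvalue l : eigenvalue K l -> exists i, l = K i i.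
Proof.
move=> /eigenvalueP[v vK /eqP v0].
have [i vi] : exists i, v 0 i != 0.
  apply: contrapT => h; apply: v0; apply/matrixP => a i; rewrite ord1 mxE.
  by apply/eqP; apply: contrapT => /negP vi; apply: h; exists i.
exists i; move/matrixP : vK => /(_ 0 i); rewrite !mxE (bigD1 i)//= big1 => [|j ji].
  by rewrite addr0 mulrC => /(mulIf vi).
by rewrite diag_posdef_off ?mulr0.
Qed.

Lemma eigenvalue_diag i : eigenvalue K (K i i).
Proof.
apply/eigenvalueP; exists (delta_mx 0 i).
  apply/matrixP => a j; rewrite ord1 -rowE !mxE eqxx/=.
  have [->|ij] := eqVneq j i; first by rewrite mulr1.
  by rewrite mulr0 diag_posdef_off// eq_sym.
apply/negP => /eqP /matrixP /(_ 0 i); rewrite !mxE !eqxx/= => /eqP.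
by rewrite oner_eq0.
Qed.

Lemma lambda_min_le i : lambda_min K <= K i i.
Proof.
apply: ge_inf; last exact: eigenvalue_diag.
by exists 0 => l /diag_posdef_eigenvalue[j ->]; exact/ltW/diag_posdef_diag.
Qed.

Lemma le_lambda_max i : K i i <= lambda_max K.
Proof.
apply: ub_le_sup; last exact: eigenvalue_diag.
(* The trace bounds every eigenvalue because all diagonal entries are positive. *)
exists (\sum_j K j j) => l /diag_posdef_eigenvalue[j ->].
rewrite (bigD1 j)//= lerDl; apply: sumr_ge0 => k _.
exact/ltW/diag_posdef_diag.
Qed.

(** An infimum of positive numbers may be 0; here it is bounded below by the least diagonal entry,
    which exists as there are finitely many. The index [i0] makes the spectrum nonempty. *)
Lemma lambda_min_gt0 (i0 : 'I_n) : 0 < lambda_min K.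
Proof.
have [i _ hi] := @Order.TotalTheory.arg_minP _ _ _ i0 xpredT (fun i => K i i) isT.
apply: (lt_le_trans (diag_posdef_diag i)); apply: lb_le_inf.
  by exists (K i0 i0); exact: eigenvalue_diag.
by move=> l /diag_posdef_eigenvalue[j ->]; exact: hi.
Qed.

Lemma mulmx_diag_posdef (x : 'cV[R]_n) i : (K *m x) i 0 = K i i * x i 0.
Proof.
rewrite !mxE (bigD1 i)//= big1 ?addr0// => j ji.
by rewrite diag_posdef_off ?mul0r// eq_sym.
Qed.

End diagonal.

Lemma mulmx_quad (R : realType) (n : nat) (x y : 'cV[R]_n) :
  (x^T *m y) 0 0 = dot x y.
Proof. by rewrite !mxE; apply: eq_bigr => i _; rewrite mxE. Qed.

(** * Entries of the inertia and Coriolis matrices *)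

Section partials.
Context {R : realType} (p : robot R).

(** The partial derivatives of [M11] and [C11] in the two steering angles. Those of [C11] in the
    rates are [M11f / 2] and [M11r / 2]. *)
Definition M11f (df dr : R) : R :=
  2 * rb_I p * rb_A p ^+ 2 * (sin df - sin dr) * cos df
  - rb_m p / 2 * sin (df - dr).
Definition M11r (df dr : R) : R :=
  rb_m p / 2 * sin (df - dr)
  - 2 * rb_I p * rb_A p ^+ 2 * (sin df - sin dr) * cos dr.
Definition C11f (df dr wf wr : R) : R :=
  rb_I p * rb_A p ^+ 2 * (cos df * (cos df * wf - cos dr * wr)
    - (sin df - sin dr) * (sin df * wf))
  - rb_m p / 4 * (cos (df - dr) * (wf - wr)).
Definition C11r (df dr wf wr : R) : R :=
  rb_I p * rb_A p ^+ 2 * ((sin df - sin dr) * (sin dr * wr)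
    - cos dr * (cos df * wf - cos dr * wr))
  + rb_m p / 4 * (cos (df - dr) * (wf - wr)).

Lemma is_derive_sin_comp (f : R -> R) (t df : R) : is_derive t 1 f df ->
  is_derive t 1 (fun s => sin (f s)) (cos (f t) * df).
Proof. by move=> ?; exact: is_derive1_comp. Qed.

Lemma is_derive_cos_comp (f : R -> R) (t df : R) : is_derive t 1 f df ->
  is_derive t 1 (fun s => cos (f s)) (- sin (f t) * df).
Proof. by move=> ?; exact: is_derive1_comp. Qed.

Lemma is_derive_mul (f g : R -> R) (t df dg : R) :
  is_derive t 1 f df -> is_derive t 1 g dg ->
  is_derive t 1 (fun s => f s * g s) (df * g t + f t * dg).
Proof.
move=> hf hg; have h : is_derive t 1 (f * g) _ := is_deriveM hf hg.
by apply: (is_derive_eq h); rewrite /GRing.scale/= addrC mulrC.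
Qed.

Lemma is_derive_add (f g : R -> R) (t df dg : R) :
  is_derive t 1 f df -> is_derive t 1 g dg ->
  is_derive t 1 (fun s => f s + g s) (df + dg).
Proof. by move=> ? ?; exact: is_deriveD. Qed.

Lemma is_derive_sub (f g : R -> R) (t df dg : R) :
  is_derive t 1 f df -> is_derive t 1 g dg ->
  is_derive t 1 (fun s => f s - g s) (df - dg).
Proof. by move=> ? ?; exact: is_deriveB. Qed.

Lemma is_derive_mulc (a : R) (f : R -> R) (t df : R) :
  is_derive t 1 f df -> is_derive t 1 (fun s => a * f s) (a * df).
Proof. by move=> ?; exact: is_deriveZ. Qed.

(** Stated along arbitrary curves because it is applied to coordinate lines for the gradient, to
    segments for the Lipschitz bound, and to the motion for [M' = 2 C]. *)
Lemma is_derive_M11 (df dr : R -> R) (t wf wr : R) :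
  is_derive t 1 df wf -> is_derive t 1 dr wr ->
  is_derive t 1 (fun s => M11 p (df s) (dr s))
    (M11f (df t) (dr t) * wf + M11r (df t) (dr t) * wr).
Proof.
move=> hf hr.
have hs := is_derive_sub (is_derive_sin_comp hf) (is_derive_sin_comp hr).
have hc := is_derive_cos_comp (is_derive_sub hf hr).
have h1 := is_derive_add (is_derive_cst (1 : R) t 1) hc.
have := is_derive_add (is_derive_add
  (is_derive_cst (4 * rb_Iphi p / rb_r p ^+ 2) t 1)
  (is_derive_mulc (rb_m p / 2) h1))
  (is_derive_mulc (rb_I p * rb_A p ^+ 2) (is_derive_mul hs hs)).
move=> h; apply: (is_derive_eq h).
by rewrite /M11f /M11r; field.
Qed.

Lemma is_derive_C11 (df dr wf wr : R -> R) (t df' dr' wf' wr' : R) :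
  is_derive t 1 df df' -> is_derive t 1 dr dr' ->
  is_derive t 1 wf wf' -> is_derive t 1 wr wr' ->
  is_derive t 1 (fun s => C11 p (df s) (dr s) (wf s) (wr s))
    (C11f (df t) (dr t) (wf t) (wr t) * df'
     + C11r (df t) (dr t) (wf t) (wr t) * dr'
     + (M11f (df t) (dr t) / 2) * wf' + (M11r (df t) (dr t) / 2) * wr').
Proof.
move=> hf hr hwf hwr.
have hs := is_derive_sub (is_derive_sin_comp hf) (is_derive_sin_comp hr).
have hd := is_derive_sin_comp (is_derive_sub hf hr).
have hw := is_derive_sub hwf hwr.
have hcw := is_derive_sub (is_derive_mul (is_derive_cos_comp hf) hwf)
                          (is_derive_mul (is_derive_cos_comp hr) hwr).
have h := is_derive_sub
  (is_derive_mul (is_derive_mulc (rb_I p * rb_A p ^+ 2) hs) hcw)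
  (is_derive_mul (is_derive_mulc (rb_m p / 4) hd) hw).
apply: (is_derive_eq h).
by rewrite /C11f /C11r /M11f /M11r; field.
Qed.

Lemma derive1_val (f : R -> R) (t d : R) : is_derive t 1 f d -> derive1 f t = d.
Proof. by move=> h; rewrite derive1E; exact: derive_val. Qed.

Lemma M11_grad df dr :
  derive1 (fun x => M11 p x dr) df = M11f df dr /\
  derive1 (fun x => M11 p df x) dr = M11r df dr.
Proof.
split; apply: derive1_val.
  apply: (is_derive_eq (is_derive_M11 (is_derive_id df 1) (is_derive_cst dr df 1))).
  by rewrite /= mulr1 mulr0 addr0.
apply: (is_derive_eq (is_derive_M11 (is_derive_cst df dr 1) (is_derive_id dr 1))).
by rewrite /= mulr1 mulr0 add0r.
Qed.

Lemma C11_grad df dr wf wr :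
  [/\ derive1 (fun x => C11 p x dr wf wr) df = C11f df dr wf wr,
      derive1 (fun x => C11 p df x wf wr) dr = C11r df dr wf wr,
      derive1 (fun x => C11 p df dr x wr) wf = M11f df dr / 2 &
      derive1 (fun x => C11 p df dr wf x) wr = M11r df dr / 2].
Proof.
split; apply: derive1_val.
- apply: (is_derive_eq (is_derive_C11 (is_derive_id df 1) (is_derive_cst dr df 1)
    (is_derive_cst wf df 1) (is_derive_cst wr df 1))).
  by rewrite /= mulr1 !mulr0 !addr0.
- apply: (is_derive_eq (is_derive_C11 (is_derive_cst df dr 1) (is_derive_id dr 1)
    (is_derive_cst wf dr 1) (is_derive_cst wr dr 1))).
  by rewrite /= mulr1 !mulr0 !addr0 add0r.
- apply: (is_derive_eq (is_derive_C11 (is_derive_cst df wf 1) (is_derive_cst dr wf 1)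
    (is_derive_id wf 1) (is_derive_cst wr wf 1))).
  by rewrite /= mulr1 !mulr0 !addr0 add0r.
- apply: (is_derive_eq (is_derive_C11 (is_derive_cst df wr 1) (is_derive_cst dr wr 1)
    (is_derive_cst wf wr 1) (is_derive_id wr 1))).
  by rewrite /= mulr1 !mulr0 !addr0 add0r.
Qed.

Lemma norm_sin_le1 (x : R) : `|sin x| <= 1.
Proof. by rewrite ler_norml sin_geN1 sin_le1. Qed.

Lemma norm_cos_le1 (x : R) : `|cos x| <= 1.
Proof. by rewrite ler_norml cos_geN1 cos_le1. Qed.

Lemma cosD1_ge0 (x : R) : 0 <= 1 + cos x.
Proof. by rewrite -lerBlDl sub0r cos_geN1. Qed.

Lemma sin_diff_bound (x y : R) : `|sin x - sin y| <= 2.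
Proof.
apply: (le_trans (ler_normB _ _)).
by rewrite (_ : 2 = 1 + 1 :> R)// lerD// norm_sin_le1.
Qed.

Lemma sin_diff_sqr_le (x y : R) : (sin x - sin y) ^+ 2 <= 4.
Proof.
rewrite -real_normK ?num_real//.
have /(lerXn2r 2) := sin_diff_bound x y; rewrite !nnegrE.
by rewrite -natrX; apply.
Qed.

Hypothesis p_pos : robot_pos p.

Let pm0 : 0 <= rb_m p. Proof. by case: p_pos => -[/ltW]. Qed.
Let pI0 : 0 <= rb_I p. Proof. by case: p_pos => -[_ /ltW]. Qed.
Let pIA0 : 0 <= rb_I p * rb_A p ^+ 2.
Proof. by rewrite mulr_ge0// sqr_ge0. Qed.

Lemma M11_ge (df dr : R) : 4 * rb_Iphi p / rb_r p ^+ 2 <= M11 p df dr.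
Proof.
by rewrite /M11 -addrA lerDl addr_ge0// mulr_ge0 ?sqr_ge0 ?divr_ge0 ?cosD1_ge0.
Qed.

Lemma M11_le (df dr : R) :
  M11 p df dr <= 4 * rb_Iphi p / rb_r p ^+ 2 + rb_m p + 4 * rb_I p * rb_A p ^+ 2.
Proof.
rewrite /M11 -!addrA lerD2l lerD//.
  rewrite -[leRHS](@divfK _ 2)// ler_wpM2l ?divr_ge0//.
  by rewrite (_ : 2 = 1 + 1 :> R)// lerD2l cos_le1.
rewrite (_ : 4 * _ * _ = rb_I p * rb_A p ^+ 2 * 4); last ring.
by rewrite ler_wpM2l// sin_diff_sqr_le.
Qed.

Lemma M11f_bound df dr :
  `|M11f df dr| <= 4 * (rb_I p * rb_A p ^+ 2) + rb_m p / 2.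
Proof.
rewrite /M11f (le_trans (ler_normB _ _))// lerD//.
  rewrite (_ : _ * cos df = rb_I p * rb_A p ^+ 2 * (2 * ((sin df - sin dr) * cos df))); last ring.
  rewrite normrM (ger0_norm pIA0) (mulrC 4) ler_wpM2l// !normrM ger0_norm//.
  have := sin_diff_bound df dr; have := norm_cos_le1 df.
  have := normr_ge0 (cos df); have := normr_ge0 (sin df - sin dr); nra.
by rewrite normrM ger0_norm ?divr_ge0// ler_piMr ?divr_ge0// norm_sin_le1.
Qed.

Lemma M11r_bound df dr :
  `|M11r df dr| <= 4 * (rb_I p * rb_A p ^+ 2) + rb_m p / 2.
Proof.
have -> : M11r df dr = M11f dr df.
  by rewrite /M11f /M11r -(opprB df dr) sinN; ring.
exact: M11f_bound.
Qed.

Lemma C11_bound df dr wf wr (w : R) : `|wf| <= w -> `|wr| <= w ->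
  `|C11 p df dr wf wr| <= (4 * rb_I p * rb_A p ^+ 2 + rb_m p / 2) * w.
Proof.
move=> hf hr.
(* [C11] is linear in the rates and is half the derivative of [M11] along them, so the gradient
   bounds of [M11] yield the constant in [const_cc]. *)
have -> : C11 p df dr wf wr =
    M11f df dr / 2 * wf + M11r df dr / 2 * wr.
  by rewrite /C11 /M11f /M11r; field.
have w0 : 0 <= w := le_trans (normr_ge0 _) hf.
have h1 : `|M11f df dr / 2 * wf| <= (4 * (rb_I p * rb_A p ^+ 2) + rb_m p / 2) / 2 * w.
  rewrite normrM ler_pM// normrM (@ger0_norm _ 2^-1)// ler_pM2r//.
  exact: M11f_bound.
have h2 : `|M11r df dr / 2 * wr| <= (4 * (rb_I p * rb_A p ^+ 2) + rb_m p / 2) / 2 * w.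
  rewrite normrM ler_pM// normrM (@ger0_norm _ 2^-1)// ler_pM2r//.
  exact: M11r_bound.
apply: (le_trans (ler_normD _ _)); apply: (le_trans (lerD h1 h2)).
by rewrite le_eqVlt; apply/orP; left; apply/eqP; field.
Qed.

Lemma normrB_trig (a b x y u v : R) :
  `|a| <= u -> `|b| <= v -> `|x| <= 1 -> `|y| <= 1 -> 0 <= u -> 0 <= v ->
  `|x * a - y * b| <= u + v.
Proof.
move=> au bv x1 y1 u0 v0; apply: (le_trans (ler_normB _ _)).
by rewrite !normrM lerD// -[leRHS]mul1r ler_pM.
Qed.

(** Makes the set behind [const_LC1] bounded above; otherwise its [sup] would be the default 0 and
    bound nothing. *)
Lemma C11f_bound df dr wf wr (w : R) : `|wf| <= w -> `|wr| <= w ->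
  `|C11f df dr wf wr| <= (4 * (rb_I p * rb_A p ^+ 2) + rb_m p / 2) * w.
Proof.
move=> hf hr.
have w0 : 0 <= w := le_trans (normr_ge0 _) hf.
have h1 : `|cos df * wf - cos dr * wr| <= w + w.
  by apply: normrB_trig => //; exact: norm_cos_le1.
have h2 : `|(sin df - sin dr) * (sin df * wf)| <= 2 * w.
  by rewrite normrM ler_pM// ?sin_diff_bound// normrM -[leRHS]mul1r ler_pM// norm_sin_le1.
have h3 : `|cos df * (cos df * wf - cos dr * wr)
    - (sin df - sin dr) * (sin df * wf)| <= 4 * w.
  apply: (le_trans (ler_normB _ _)).
  have : `|cos df * (cos df * wf - cos dr * wr)| <= 2 * w.
    by rewrite normrM -[leRHS]mul1r ler_pM// ?norm_cos_le1//; move: h1; lra.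
  by move: h2; lra.
have h4 : `|cos (df - dr) * (wf - wr)| <= 2 * w.
  rewrite normrM -[leRHS]mul1r ler_pM// ?norm_cos_le1//.
  by rewrite (le_trans (ler_normB _ _))//; move: hf hr; lra.
rewrite /C11f (le_trans (ler_normB _ _))//.
rewrite !(normrM (rb_I p * _)) !(normrM (rb_m p / 4)) (ger0_norm pIA0).
rewrite (@ger0_norm _ (rb_m p / 4)) ?divr_ge0//.
have -> : (4 * (rb_I p * rb_A p ^+ 2) + rb_m p / 2) * w =
    rb_I p * rb_A p ^+ 2 * (4 * w) + rb_m p / 4 * (2 * w) by field.
by rewrite lerD// ler_wpM2l// divr_ge0.
Qed.

Lemma C11r_bound df dr wf wr (w : R) : `|wf| <= w -> `|wr| <= w ->
  `|C11r df dr wf wr| <= (4 * (rb_I p * rb_A p ^+ 2) + rb_m p / 2) * w.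
Proof.
move=> hf hr.
have -> : C11r df dr wf wr = C11f dr df wr wf.
  by rewrite /C11f /C11r -(opprB df dr) cosN; ring.
exact: C11f_bound.
Qed.

End partials.

(** * Lipschitz estimates *)

Section lipschitz.
Context {R : realType} (S : system R).
Let p := sy_rb S.
Hypothesis p_pos : robot_pos p.
Hypothesis Ditv : is_interval (sy_Ddelta S).

Definition pair2 (x y : R) : 'cV[R]_2 := col_of 2 [:: x; y].

Lemma dot_pair2 x y u v : dot (pair2 x y) (pair2 u v) = x * u + y * v.
Proof. by rewrite /dot !big_ord_recl big_ord0 addr0 !mxE. Qed.

Lemma norm2_pair2 x y : norm2 (pair2 x y) = Num.sqrt (x ^+ 2 + y ^+ 2).
Proof. by congr Num.sqrt; rewrite !big_ord_recl big_ord0 addr0 !mxE. Qed.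

Lemma norm2_pair2_le x y : norm2 (pair2 x y) <= `|x| + `|y|.
Proof.
apply: norm2_le_sqr; first exact: addr_ge0.
rewrite norm2_sqr !big_ord_recl big_ord0 addr0 !mxE/=.
rewrite -(real_normK (num_real x)) -(real_normK (num_real y)).
by have := mulr_ge0 (normr_ge0 x) (normr_ge0 y); nra.
Qed.

Lemma norm2_pair2N x y : norm2 (pair2 (- x) (- y)) = norm2 (pair2 x y).
Proof. by rewrite !norm2_pair2 !sqrrN. Qed.

Lemma norm_dot_pair2 x y u v :
  `|x * u + y * v| <= norm2 (pair2 x y) * norm2 (pair2 u v).
Proof.
rewrite ler_norml -{2}dot_pair2 dot_le_norm2 andbT lerNl.
rewrite (_ : - _ = x * - u + y * - v); last ring.
by rewrite -dot_pair2 -(norm2_pair2N u v) dot_le_norm2.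
Qed.

(** Applied to [M11] or [C11] restricted to the segment joining two pairs of angles, which turns a
    gradient bound into a Lipschitz bound. *)
Lemma mean_value_unit (g g' : R -> R) : (forall x : R, is_derive x 1 g (g' x)) ->
  exists2 s, 0 <= s <= 1 & g 1 - g 0 = g' s.
Proof.
move=> hg; have gc : {within `[0, 1], continuous g}.
  by apply: derivable_within_continuous => x _; have [] := hg x.
have [s] := MVT_segment ler01 (fun x _ => hg x) gc.
by rewrite in_itv/= subr0 mulr1 => s01 ->; exists s.
Qed.

Lemma Ddelta_segment x y s : sy_Ddelta S x -> sy_Ddelta S y -> 0 <= s <= 1 ->
  sy_Ddelta S (x + s * (y - x)).
Proof.
move=> Dx Dy /andP[s0 s1]; have [xy|/ltW yx] := leP x y.
  apply: (Ditv Dx Dy); rewrite lerDl mulr_ge0 ?subr_ge0//=.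
  by rewrite -lerBrDl ler_piMl ?subr_ge0.
apply: (Ditv Dy Dx); rewrite gerDl mulr_ge0_le0 ?subr_le0// andbT.
by rewrite -lerBlDl ler_niMl ?subr_le0.
Qed.

Lemma is_derive_segment (x y s : R) :
  is_derive s 1 (fun s => x + s * (y - x)) (y - x).
Proof.
apply: (is_derive_eq (is_derive_add (is_derive_cst x s 1)
  (is_derive_mul (is_derive_id s 1) (is_derive_cst (y - x) s 1)))).
by rewrite /=; ring.
Qed.

Lemma const_LM_ge (df dr : R) : sy_Ddelta S df -> sy_Ddelta S dr ->
  norm2 (pair2 (M11f p df dr) (M11r p df dr)) <= const_LM S.
Proof.
move=> hf hr; apply: ub_le_sup; last first.
  by exists df, dr; have [-> ->] := M11_grad p df dr.
pose b := 4 * (rb_I p * rb_A p ^+ 2) + rb_m p / 2.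
exists (b + b) => _ [x [y [_ _ ->]]]; have [-> ->] := M11_grad p x y.
by rewrite (le_trans (norm2_pair2_le _ _))// lerD ?M11f_bound ?M11r_bound.
Qed.

Lemma const_LC1_ge (df dr wf wr : R) : sy_Ddelta S df -> sy_Ddelta S dr ->
  `|wf| <= sy_ddmax S -> `|wr| <= sy_ddmax S ->
  norm2 (pair2 (C11f p df dr wf wr) (C11r p df dr wf wr)) <= const_LC1 S.
Proof.
move=> hf hr hwf hwr; apply: ub_le_sup; last first.
  by exists df, dr, wf, wr; have [-> -> _ _] := C11_grad p df dr wf wr.
pose b := (4 * (rb_I p * rb_A p ^+ 2) + rb_m p / 2) * sy_ddmax S.
exists (b + b) => _ [x [y [u [v [_ _ ux vx ->]]]]].
have [-> -> _ _] := C11_grad p x y u v.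
by rewrite (le_trans (norm2_pair2_le _ _))// lerD ?C11f_bound ?C11r_bound.
Qed.

Lemma const_LC2_ge (df dr wf wr : R) : sy_Ddelta S df -> sy_Ddelta S dr ->
  `|wf| <= sy_ddmax S -> `|wr| <= sy_ddmax S ->
  norm2 (pair2 (M11f p df dr / 2) (M11r p df dr / 2)) <= const_LC2 S.
Proof.
move=> hf hr hwf hwr; apply: ub_le_sup; last first.
  by exists df, dr, wf, wr; have [_ _ -> ->] := C11_grad p df dr wf wr.
pose b := (4 * (rb_I p * rb_A p ^+ 2) + rb_m p / 2) / 2.
exists (b + b) => _ [x [y [u [v [_ _ ux vx ->]]]]].
have [_ _ -> ->] := C11_grad p x y u v.
rewrite (le_trans (norm2_pair2_le _ _))// !normrM (@ger0_norm _ 2^-1)//.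
by rewrite lerD// ler_pM2r// ?M11f_bound ?M11r_bound.
Qed.

Lemma M11_lipschitz (x y x' y' : R) : sy_Ddelta S x -> sy_Ddelta S y ->
  sy_Ddelta S x' -> sy_Ddelta S y' ->
  `|M11 p x' y' - M11 p x y| <= const_LM S * norm2 (pair2 (x' - x) (y' - y)).
Proof.
move=> hx hy hx' hy'; have [s s01] := mean_value_unit
  (fun s => is_derive_M11 p (is_derive_segment x x' s) (is_derive_segment y y' s)).
rewrite !mul0r !mul1r !addr0 !subrKC => ->.
apply: (le_trans (norm_dot_pair2 _ _ _ _)); rewrite ler_wpM2r ?norm2_ge0//.
by apply: const_LM_ge; exact: Ddelta_segment.
Qed.

(** The angles are changed first, at the rates [u], [v], by the mean value theorem; the rates are
    changed next, at the angles [x'], [y'], where linearity gives an exact inner product. *)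
Lemma C11_lipschitz (x y u v x' y' u' v' : R) : sy_Ddelta S x -> sy_Ddelta S y ->
  sy_Ddelta S x' -> sy_Ddelta S y' ->
  `|u| <= sy_ddmax S -> `|v| <= sy_ddmax S ->
  `|C11 p x' y' u' v' - C11 p x y u v| <=
  const_LC1 S * norm2 (pair2 (x' - x) (y' - y)) +
  const_LC2 S * norm2 (pair2 (u' - u) (v' - v)).
Proof.
move=> hx hy hx' hy' hu hv.
rewrite -(subrKA (C11 p x' y' u v)) addrC (le_trans (ler_normD _ _))// lerD//.
  have [s s01] := mean_value_unit
    (fun s => is_derive_C11 p (is_derive_segment x x' s) (is_derive_segment y y' s)
      (is_derive_cst u s 1) (is_derive_cst v s 1)).
  rewrite /= !mul0r !mul1r !addr0 !subrKC !mulr0 !addr0 => ->.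
  apply: (le_trans (norm_dot_pair2 _ _ _ _)); rewrite ler_wpM2r ?norm2_ge0//.
  by apply: const_LC1_ge => //; exact: Ddelta_segment.
have -> : C11 p x' y' u' v' - C11 p x' y' u v =
    M11f p x' y' / 2 * (u' - u) + M11r p x' y' / 2 * (v' - v).
  by rewrite /C11 /M11f /M11r; field.
apply: (le_trans (norm_dot_pair2 _ _ _ _)); rewrite ler_wpM2r ?norm2_ge0//.
exact: (const_LC2_ge hx' hy' hu hv).
Qed.

Lemma const_LM_ge0 : 0 <= const_LM S.
Proof. by apply: sup_nneg => _ [? [? [_ _ ->]]]; exact: norm2_ge0. Qed.

Lemma const_LC1_ge0 : 0 <= const_LC1 S.
Proof. by apply: sup_nneg => _ [? [? [? [? [_ _ _ _ ->]]]]]; exact: norm2_ge0. Qed.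

Lemma const_LC2_ge0 : 0 <= const_LC2 S.
Proof. by apply: sup_nneg => _ [? [? [? [? [_ _ _ _ ->]]]]]; exact: norm2_ge0. Qed.

End lipschitz.

(** * Jacobian and uncertainty *)

(** With [z = A^T y], [|z|^2 = y.(A z) <= |y| s |z|], and a nonzero [|z|] cancels. *)
Lemma norm2_mul_tr (R : realType) (m n : nat) (A : 'M[R]_(m, n)) (s : R) :
  0 <= s -> (forall x, norm2 (A *m x) <= s * norm2 x) ->
  forall y, norm2 (A^T *m y) <= s * norm2 y.
Proof.
move=> s0 hA y; set z := A^T *m y.
have [z0|z0] := eqVneq (norm2 z) 0; first by rewrite z0 mulr_ge0// norm2_ge0.
have zpos : 0 < norm2 z by rewrite lt_neqAle norm2_ge0 eq_sym z0.
rewrite -(ler_pM2r zpos) -expr2 -dotxx.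
have -> : dot z z = dot y (A *m z).
  by rewrite -!mulmx_quad {1}/z trmx_mul trmxK mulmxA.
apply: (le_trans (dot_le_norm2 _ _)).
by rewrite mulrC mulrAC ler_wpM2r ?norm2_ge0// hA.
Qed.

Section jacobian.
Context {R : realType} (p : robot R).
Hypothesis r_gt0 : 0 < rb_r p.

Lemma norm2_sqr3 (v : 'cV[R]_3) :
  norm2 v ^+ 2 = v 0 0 ^+ 2 + v iv_f 0 ^+ 2 + v iv_r 0 ^+ 2.
Proof.
rewrite norm2_sqr !big_ord_recl big_ord0 addr0 addrA.
by congr (_ + _ ^+ 2 + _ ^+ 2); congr (v _ _); exact/val_inj.
Qed.

Definition Jcol (q : 'cV[R]_6) : seq R :=
  let th := q ix_th 0 in let df := q ix_df 0 in let dr := q ix_dr 0 in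
  [:: (cos (df + th) + cos (dr + th)) / 2; (sin (df + th) + sin (dr + th)) / 2;
      rb_A p * (sin df - sin dr); (rb_r p)^-1; 0; 0].

Lemma Jmx_mulE q (v : 'cV[R]_3) i : (Jmx p q *m v) i 0 =
  (Jcol q)`_i * v 0 0 + (i == ix_df)%:R * v iv_f 0 + (i == ix_dr)%:R * v iv_r 0.
Proof.
rewrite !mxE !big_ord_recl big_ord0 addr0 addrA !mxE.
by congr (_ * _ + _ * _ + _ * _); congr (v _ _); exact/val_inj.
Qed.

Lemma Jmx_mul_steer q (v : 'cV[R]_3) :
  (Jmx p q *m v) ix_df 0 = v iv_f 0 /\ (Jmx p q *m v) ix_dr 0 = v iv_r 0.
Proof. by rewrite !Jmx_mulE /= !mul0r !mul1r !add0r addr0. Qed.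

(** [(a + b)^2 <= 2 a^2 + 2 b^2] with [cos^2 + sin^2 = 1] bounds the two translational entries
    together, and [|sin df - sin dr| <= 2] bounds the third. *)
Lemma Jcol_bound q : (Jcol q)`_0 ^+ 2 + (Jcol q)`_1 ^+ 2 + (Jcol q)`_2 ^+ 2
  <= 2 + 4 * rb_A p ^+ 2.
Proof.
rewrite /=; set df := q ix_df 0; set dr := q ix_dr 0; set th := q ix_th 0.
have := cos2Dsin2 (df + th); have := cos2Dsin2 (dr + th).
have h := sin_diff_sqr_le df dr.
have := ler_wpM2l (sqr_ge0 (rb_A p)) h; rewrite -exprMn.
have := sqr_ge0 (cos (df + th) - cos (dr + th)).
have := sqr_ge0 (sin (df + th) - sin (dr + th)).
set a := cos _; set b := sin _; set c := cos _; set d := sin _; set e := rb_A p * _.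
by nra.
Qed.

Lemma weighted_quadE (w : R) (x : 'cV[R]_6) : (x^T *m diag_of 6 [:: 1; 1; 1; w; 1; 1] *m x) 0 0 =
  x ix_x 0 ^+ 2 + x ix_y 0 ^+ 2 + x ix_th 0 ^+ 2 + w * x ix_phi 0 ^+ 2
  + x ix_df 0 ^+ 2 + x ix_dr 0 ^+ 2.
Proof.
rewrite mul_mx_diag mxE !big_ord_recl big_ord0 !mxE/=.
set a := x _ _; set b := x _ _; set c := x _ _; set d := x _ _; set e := x _ _; set f := x _ _.
have -> : x ix_x 0 = a by congr (x _ _); exact/val_inj.
have -> : x ix_y 0 = b by congr (x _ _); exact/val_inj.
have -> : x ix_th 0 = c by congr (x _ _); exact/val_inj.
have -> : x ix_phi 0 = d by congr (x _ _); exact/val_inj.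
have -> : x ix_df 0 = e by congr (x _ _); exact/val_inj.
have -> : x ix_dr 0 = f by congr (x _ _); exact/val_inj.
ring.
Qed.

(** The wheel weight [w] is free: [w = 1] gives the Euclidean norm of [J v], and [w = r^2] the
    weighted one, where the factor [1/r^2] cancels. *)
Lemma Jmx_weighted (w : R) q (v : 'cV[R]_3) : 0 <= w ->
  ((Jmx p q *m v)^T *m diag_of 6 [:: 1; 1; 1; w; 1; 1] *m (Jmx p q *m v)) 0 0
  <= (3 + 4 * rb_A p ^+ 2 + w * (rb_r p)^-1 ^+ 2) * norm2 v ^+ 2.
Proof.
move=> w0; rewrite weighted_quadE norm2_sqr3 !Jmx_mulE /= !(mul0r, mul1r, add0r, addr0).
have h := Jcol_bound q; rewrite /= in h.
set a := _ / 2 in h *; set b := (sin _ + _) / 2 in h *; set c := rb_A p * _ in h *.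
have := ler_wpM2r (sqr_ge0 (v 0 0)) h.
have := mulr_ge0 (mulr_ge0 w0 (sqr_ge0 (rb_r p)^-1)) (sqr_ge0 (v iv_f 0)).
have := mulr_ge0 (mulr_ge0 w0 (sqr_ge0 (rb_r p)^-1)) (sqr_ge0 (v iv_r 0)).
have := mulr_ge0 (sqr_ge0 (rb_A p)) (sqr_ge0 (v iv_f 0)).
have := mulr_ge0 (sqr_ge0 (rb_A p)) (sqr_ge0 (v iv_r 0)).
have := sqr_ge0 (v iv_f 0); have := sqr_ge0 (v iv_r 0); have := sqr_ge0 (v 0 0).
move: (v 0 0) (v iv_f 0) (v iv_r 0) => x y z.
lra.
Qed.

Lemma norm2_sqr_quad (x : 'cV[R]_6) :
  norm2 x ^+ 2 = (x^T *m diag_of 6 [:: 1; 1; 1; 1; 1; 1] *m x) 0 0.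
Proof.
rewrite weighted_quadE norm2_sqr !big_ord_recl big_ord0 addr0 mul1r !addrA.
by congr (_ ^+ 2 + _ ^+ 2 + _ ^+ 2 + _ ^+ 2 + _ ^+ 2 + _ ^+ 2);
  congr (x _ _); exact/val_inj.
Qed.

(** A Euclidean bound of J, uniform in q and valid for every wheel radius; it keeps the entry [1/r]
    in full. *)
Definition Jbound : R := Num.sqrt (3 + 4 * rb_A p ^+ 2 + (rb_r p)^-1 ^+ 2).

Lemma norm2_Jmx_le q (v : 'cV[R]_3) : norm2 (Jmx p q *m v) <= Jbound * norm2 v.
Proof.
have k0 : 0 <= 3 + 4 * rb_A p ^+ 2 + (rb_r p)^-1 ^+ 2.
  by have := sqr_ge0 (rb_A p); have := sqr_ge0 (rb_r p)^-1; lra.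
apply: norm2_le_sqr; first by rewrite mulr_ge0 ?norm2_ge0 ?sqrtr_ge0.
rewrite norm2_sqr_quad (le_trans (Jmx_weighted _ _ ler01))// mul1r.
by rewrite [leRHS]exprMn (sqr_sqrtr k0).
Qed.

Lemma normW_Jmx_le q (v : 'cV[R]_3) :
  normW p (Jmx p q *m v) <= Num.sqrt (4 + 4 * rb_A p ^+ 2) * norm2 v.
Proof.
have k0 : 0 <= 4 + 4 * rb_A p ^+ 2 by have := sqr_ge0 (rb_A p); lra.
rewrite /normW -(@ger0_norm _ (norm2 v)) ?norm2_ge0// -sqrtr_sqr -sqrtrM//.
rewrite ler_wsqrtr// (le_trans (Jmx_weighted _ _ (sqr_ge0 _)))//.
rewrite -exprMn mulfV ?gt_eqF// expr1n.
by rewrite ler_wpM2r ?sqr_ge0//; lra.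
Qed.

Lemma norm2_le_normW (x : 'cV[R]_6) : 1 <= rb_r p -> norm2 x <= normW p x.
Proof.
move=> r1; rewrite -(@ger0_norm _ (norm2 x)) ?norm2_ge0// -sqrtr_sqr.
rewrite ler_wsqrtr// norm2_sqr_quad !weighted_quadE !lerD2r lerD2l ler_wpM2r ?sqr_ge0//.
by rewrite expr_ge1// (le_trans ler01).
Qed.

End jacobian.

Section sigma.
Context {R : realType} (S : system R).
Let p := sy_rb S.
Hypothesis r_gt0 : 0 < rb_r p.

Lemma normW_Jmx_opnorm q (v : 'cV[R]_3) :
  normW p (Jmx p q *m v) <= opnorm (@norm2 R 3) (normW p) (mulmx (Jmx p q)) * norm2 v.
Proof.
have [->|v0] := eqVneq v 0.
  by rewrite mulmx0 norm20 mulr0 /normW mulmx0 mxE sqrtr0.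
rewrite -ler_pdivrMr ?norm2_gt0//; apply: ub_le_sup; last by exists v.
exists (Num.sqrt (4 + 4 * rb_A p ^+ 2)) => _ [u u0 <-].
by rewrite ler_pdivrMr ?norm2_gt0// normW_Jmx_le.
Qed.

Lemma opnorm_le_sigma_J q : sy_X S q ->
  opnorm (@norm2 R 3) (normW p) (mulmx (Jmx p q)) <= sigma_J S.
Proof.
move=> Xq; apply: ub_le_sup; last by exists q.
exists (Num.sqrt (4 + 4 * rb_A p ^+ 2)) => _ [u Xu <-].
apply: ge_sup0; first exact: sqrtr_ge0.
by move=> _ [v v0 <-]; rewrite ler_pdivrMr ?norm2_gt0// normW_Jmx_le.
Qed.

Lemma normW_Jmx_sigma q (v : 'cV[R]_3) : sy_X S q ->
  normW p (Jmx p q *m v) <= sigma_J S * norm2 v.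
Proof.
move=> Xq; apply: (le_trans (normW_Jmx_opnorm _ _)).
by rewrite ler_wpM2r ?norm2_ge0// opnorm_le_sigma_J.
Qed.

Lemma sigma_J_ge1 q : sy_X S q -> 1 <= sigma_J S.
Proof.
(* A unit steering rate is mapped by J to a basis vector of weight 1. *)
move=> Xq; pose v : 'cV[R]_3 := delta_mx iv_f 0.
have v1 : norm2 v = 1.
  apply/eqP; rewrite -(@pexpr_eq1 _ _ 2) ?norm2_ge0// norm2_sqr3 !mxE/=.
  by rewrite expr0n expr1n /= addr0 add0r.
have := normW_Jmx_sigma v Xq; rewrite v1 mulr1; apply: le_trans.
rewrite /normW weighted_quadE !Jmx_mulE !mxE/=.
by rewrite !(mulr0, mul0r, mul1r, addr0, add0r) !expr0n mulr0 !addr0 !add0r expr1n sqrtr1.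
Qed.

Lemma sigma_J_ge0 : 0 <= sigma_J S.
Proof.
apply: sup_nneg => _ [q _ <-].
by apply: opnorm_ge0 => x; [exact: norm2_ge0|exact: sqrtr_ge0].
Qed.

Lemma sigma_dJ_ge0 : 0 <= sigma_dJ S.
Proof.
apply: sup_nneg => _ [q _ <-].
apply: opnorm_ge0 => x; first exact: norm2_ge0.
by apply: opnorm_ge0; exact: norm2_ge0.
Qed.

Hypothesis Sf : uncertainty_ok S.

Lemma norm2_f_le q v : sy_X S q ->
  norm2 (sy_f S q v) <= norm2 (c_vec S) + norm2 (d_vec S) * norm2 v.
Proof.
move=> Xq; have [_ _ _ _ [gh0 fgh ub]] := Sf.
(* The velocity-dependent part of the bound of f; its norm is at most [|d| |v|] since each [|v_k|]
   is at most [|v|]. *)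
pose u : 'cV[R]_6 := \col_k (d_vec S k 0 * `|v k 0|).
have gc k : sy_g S q k 0 <= c_vec S k 0.
  by rewrite mxE; apply: ub_le_sup; [have [] := ub k|exists q].
have hd k : sy_h S q k 0 <= d_vec S k 0.
  by rewrite mxE; apply: ub_le_sup; [have [] := ub k|exists q].
have c0 k : 0 <= c_vec S k 0 by apply: le_trans (gc k); have [] := gh0 k q.
have d0 k : 0 <= d_vec S k 0 by apply: le_trans (hd k); have [] := gh0 k q.
apply: (@le_trans _ _ (norm2 (c_vec S + u))).
  apply: norm2_mono => k; apply: (le_trans (fgh k q v)).
  rewrite [X in _ <= `|X|]mxE [u _ _]mxE [leRHS]ger0_norm; last by rewrite addr_ge0// mulr_ge0.
  by rewrite lerD// ler_wpM2r.
apply: (le_trans (norm2_triangle _ _)); rewrite lerD2l.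
rewrite mulrC -(ger0_norm (norm2_ge0 v)) -norm2Z.
apply: norm2_mono => k; rewrite !mxE mulrC !normrM ler_wpM2r//.
by rewrite normr_id (ger0_norm (norm2_ge0 v)) norm_coord_le.
Qed.

(** J is used twice, inside f and, transposed, outside it, with the same constant. Keeping [s] free
    allows both [sigma_J] and [Jbound]. *)
Lemma norm2_ftilde_le (s : R) q v : 0 <= s ->
  (forall x, norm2 (Jmx p q *m x) <= s * norm2 x) -> sy_X S q ->
  norm2 (ftilde S q v) <= s * (norm2 (c_vec S) + norm2 (d_vec S) * (s * norm2 v)).
Proof.
move=> s0 hs Xq; apply: (le_trans (norm2_mul_tr s0 hs _)); rewrite ler_wpM2l//.
apply: (le_trans (norm2_f_le _ Xq)); rewrite lerD2l ler_wpM2l ?norm2_ge0//.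
Qed.

Lemma ftilde_estimate_r_ge1 : 1 <= rb_r p -> ftilde_estimate S.
Proof.
move=> r1 tr t /cl_op/[apply] -[Xq _ _ _].
rewrite /c_tilde /d_tilde expr2 (_ : _ + _ = sigma_J S * (norm2 (c_vec S) +
  norm2 (d_vec S) * (sigma_J S * norm2 (tr_vd tr t)))); last ring.
apply: norm2_ftilde_le => //; first exact: sigma_J_ge0.
by move=> x; rewrite (le_trans (norm2_le_normW _ r1))// normW_Jmx_sigma.
Qed.

End sigma.

(** * Derivative of the Lyapunov function *)

Section weighted_sums.
Context {R : realType} {n : nat}.
Implicit Types (w : 'I_n -> R) (x y : 'cV[R]_n).

Lemma wdot_le w (b : R) x y : (forall i, `|w i| <= b) ->
  \sum_i w i * (x i 0 * y i 0) <= b * (norm2 x * norm2 y).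
Proof.
(* Only a coordinate forces [0 <= b], so the empty index type is treated apart; both sides vanish
   there. *)
move=> wb; have [i0|/card_gt0P[i _]] := leqP #|'I_n| 0.
  rewrite big1 => [|i]; last by move: i0; rewrite leqn0 => /eqP/card0_eq/(_ i).
  have -> : norm2 x = 0; last by rewrite mul0r mulr0.
  rewrite /norm2 big1 ?sqrtr0// => i.
  by move: i0; rewrite leqn0 => /eqP/card0_eq/(_ i).
have b0 : 0 <= b := le_trans (normr_ge0 _) (wb i).
pose z : 'cV[R]_n := \col_i (w i * x i 0).
have -> : \sum_i w i * (x i 0 * y i 0) = dot z y.
  by apply: eq_bigr => j _; rewrite mxE mulrA.
apply: (le_trans (dot_le_norm2 _ _)); rewrite mulrA ler_wpM2r ?norm2_ge0//.
rewrite -(ger0_norm b0) -norm2Z; apply: norm2_mono => j.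
by rewrite !mxE !normrM ler_wpM2r// (ger0_norm b0).
Qed.

Lemma wdot_ge w (b : R) x : (forall i, b <= w i) ->
  b * norm2 x ^+ 2 <= \sum_i w i * x i 0 ^+ 2.
Proof.
by move=> wb; rewrite norm2_sqr mulr_sumr ler_sum// => i _; rewrite ler_wpM2r// sqr_ge0.
Qed.

Lemma wdot_sqr_le w (b : R) x : (forall i, w i <= b) ->
  \sum_i w i * x i 0 ^+ 2 <= b * norm2 x ^+ 2.
Proof.
by move=> wb; rewrite norm2_sqr mulr_sumr ler_sum// => i _; rewrite ler_wpM2r// sqr_ge0.
Qed.

Lemma norm2_wcol_le w (b : R) x : 0 <= b -> (forall i, `|w i| <= b) ->
  norm2 (\col_i (w i * x i 0)) <= b * norm2 x.
Proof.
move=> b0 wb; rewrite -(ger0_norm b0) -norm2Z; apply: norm2_mono => j.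
by rewrite !mxE !normrM ler_wpM2r// (ger0_norm b0).
Qed.

End weighted_sums.

Section coordinates.
Context {R : realType} {n : nat}.

Lemma is_derive_coord (f : R -> 'cV[R]_n) (t : R) df (i : 'I_n) :
  is_derive t 1 f df -> is_derive t 1 (fun s => f s i 0) (df i 0).
Proof.
move=> [hf fE]; split; first by have /derivable_mxP := hf; exact.
by rewrite -fE derive_mx// mxE.
Qed.

End coordinates.

(** Young's inequality with weight [k / 4], so that several products can be absorbed into one
    damping term of coefficient [k]. *)
Lemma peter_paul (R : realFieldType) (k x y : R) : 0 < k ->
  x * y <= k / 4 * x ^+ 2 + y ^+ 2 / k.
Proof.
move=> k0; rewrite -subr_ge0.
have -> : k / 4 * x ^+ 2 + y ^+ 2 / k - x * y = (k * x / 2 - y) ^+ 2 / k.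
  by field; rewrite gt_eqF.
by rewrite divr_ge0 ?sqr_ge0// ltW.
Qed.

(** * Scalar form of the dynamics *)

Section diagonal_dynamics.
Context {R : realType} (S : system R).
Let p := sy_rb S.
Hypothesis p_pos : robot_pos p.

(** Indexed entries allow sums over coordinates. [Cdiag] takes the reduced velocity instead of
    [J v], whose steering rates are components of v. *)
Definition Mdiag (q : 'cV[R]_6) (i : 'I_3) : R :=
  [:: M11 p (q ix_df 0) (q ix_dr 0); 2 * rb_Idelta p; 2 * rb_Idelta p]`_i.
Definition Cdiag (q : 'cV[R]_6) (v : 'cV[R]_3) (i : 'I_3) : R :=
  [:: C11 p (q ix_df 0) (q ix_dr 0) (v iv_f 0) (v iv_r 0); 0; 0]`_i.

Lemma Mt_mulE q (y : 'cV[R]_3) i : (Mt p q *m y) i 0 = Mdiag q i * y i 0.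
Proof. by rewrite mul_diag_mx !mxE. Qed.

Lemma Ct_mulE q (v y : 'cV[R]_3) i : (Ct p q (Jmx p q *m v) *m y) i 0 = Cdiag q v i * y i 0.
Proof. by rewrite /Ct; have [-> ->] := Jmx_mul_steer p q v; rewrite mul_diag_mx !mxE. Qed.

Lemma Bt_unit q : Bt p q \in unitmx.
Proof.
rewrite unitmxE det_diag unitfE; apply/prodf_neq0 => i _; rewrite mxE gt_eqF//.
have [_ [r0 a0 b0]] := p_pos.
case: i => -[|[|[|]]]//= _; rewrite /B11 mulr_gt0 ?invr_gt0// ltr_wpDl//.
apply: addr_ge0; first by apply: mulr_ge0; rewrite ?cosD1_ge0.
by apply: mulr_ge0; rewrite ?sqr_ge0// divr_ge0 ?addr_ge0 ?sqr_ge0.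
Qed.

Lemma const_a1_le q i : const_a1 S <= Mdiag q i.
Proof.
rewrite /const_a1 /Mdiag; case: i => -[|[|[|]]]//= _; rewrite ge_min ?lexx ?orbT//.
by rewrite M11_ge.
Qed.

Lemma const_a2_ge q i : Mdiag q i <= const_a2 S.
Proof.
rewrite /const_a2 /Mdiag; case: i => -[|[|[|]]]//= _; rewrite le_max ?lexx ?orbT//.
by rewrite M11_le.
Qed.

Lemma const_a1_gt0 : 0 < const_a1 S.
Proof.
by have [[_ _ ? ?] [? _ _]] := p_pos; rewrite /const_a1 lt_min divr_gt0 ?mulr_gt0 ?exprn_gt0.
Qed.

Lemma Mdiag_ge0 q i : 0 <= Mdiag q i.
Proof. exact: le_trans (ltW const_a1_gt0) (const_a1_le q i). Qed.

Lemma Mdiag_norm q i : `|Mdiag q i| <= const_a2 S.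
Proof. by rewrite ger0_norm ?const_a2_ge// Mdiag_ge0. Qed.

Lemma const_a2_gt0 : 0 < const_a2 S.
Proof.
apply: lt_le_trans (const_a2_ge 0 0); exact: lt_le_trans const_a1_gt0 (const_a1_le _ _).
Qed.

Lemma Cdiag_norm q (v : 'cV[R]_3) i : `|v iv_f 0| <= sy_ddmax S ->
  `|v iv_r 0| <= sy_ddmax S -> `|Cdiag q v i| <= const_cc S.
Proof.
move=> hf hr; have w0 := le_trans (normr_ge0 _) hf.
have := C11_bound p_pos (q ix_df 0) (q ix_dr 0) hf hr.
rewrite /Cdiag; case: i => -[|[|[|]]]//= _ h; rewrite ?normr0//.
all: by apply: le_trans h.
Qed.

Lemma Wfun_sum (delta : R) q (e eta : 'cV[R]_3) : diag_posdef (sy_KI S) ->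
  Wfun S delta q e eta =
  \sum_i (Mdiag q i * e i 0 ^+ 2 / 2 + sy_KI S i i * eta i 0 ^+ 2 / 2
          + delta * (Mdiag q i * (e i 0 * eta i 0))).
Proof.
move=> KI; rewrite /Wfun -!mulmxA !mulmx_quad /dot !mulr_suml mulr_sumr -!big_split/=.
by apply: eq_bigr => i _; rewrite !Mt_mulE mulmx_diag_posdef//; field.
Qed.

(* The passivity property [M' = 2 C]. *)
Lemma is_derive_Mdiag (q : R -> 'cV[R]_6) (v : 'cV[R]_3) (t : R) i :
  is_derive t 1 q (Jmx p (q t) *m v) ->
  is_derive t 1 (fun s => Mdiag (q s) i) (2 * Cdiag (q t) v i).
Proof.
move=> hq; have hf := is_derive_coord ix_df hq; have hr := is_derive_coord ix_dr hq.
move: hf hr; have [-> ->] := Jmx_mul_steer p (q t) v => hf hr.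
rewrite /Mdiag /Cdiag; case: i => -[|[|[|]]]//= _.
- by apply: (is_derive_eq (is_derive_M11 p hf hr)); rewrite /M11f /M11r /C11; field.
- by rewrite mulr0; exact: is_derive_cst.
- by rewrite mulr0; exact: is_derive_cst.
Qed.

End diagonal_dynamics.

Section lyapunov_derivative.
Context {R : realType} (S : system R) (delta : R) (tr : trajectory R).
Let p := sy_rb S.
Hypothesis S_ok : system_ok S.
Hypothesis cl : closed_loop S tr.

Let p_pos : robot_pos p. Proof. by case: S_ok. Qed.
Let KPpd : diag_posdef (sy_KP S). Proof. by case: S_ok => _ _ _ _ []. Qed.
Let KIpd : diag_posdef (sy_KI S). Proof. by case: S_ok => _ _ _ _ []. Qed.

(** Obtained by subtracting [M(q) v_d'] from the dynamics and splitting [C v = C e + C v_d]: the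
    Coriolis mismatch multiplies [v_d], and the uncertainty is taken at the actual velocity. *)
Definition residual (t : R) : 'cV[R]_3 :=
  \col_i ((Mdiag S (tr_qd tr t) i - Mdiag S (tr_q tr t) i) * derive1 (tr_vd tr) t i 0)
  + \col_i ((Cdiag S (tr_qd tr t) (tr_vd tr t) i
             - Cdiag S (tr_q tr t) (tr_v tr t) i) * tr_vd tr t i 0)
  - ftilde S (tr_q tr t) (tr_v tr t).

(** The derivative [de] stays multiplied by its inertia entry, the form in which it occurs in the
    derivative of W, so M is never inverted. *)
Lemma error_dynamics (t : R) (i : 'I_3) : 0 < t ->
  exists de : R, is_derive t 1 (fun s => tr_e tr s i 0) de /\
  Mdiag S (tr_q tr t) i * de =
  - (Cdiag S (tr_q tr t) (tr_v tr t) i + sy_KP S i i) * tr_e tr t i 0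
  - sy_KI S i i * tr_eta tr t i 0 + residual t i 0.
Proof.
move=> t0; have [dv /= eqn] := cl_v cl t0; have dvd := cl_vd cl t0.
have hv := is_derive_coord i (derivableP dv).
have hvd := is_derive_coord i (derivableP dvd).
exists ('D_1 (tr_v tr) t i 0 - 'D_1 (tr_vd tr) t i 0); split.
  have -> : (fun s => tr_e tr s i 0) = (fun s => tr_v tr s i 0 - tr_vd tr s i 0).
    by apply/funext => s; rewrite !mxE.
  exact: is_derive_sub.
move/matrixP : eqn => /(_ i 0); rewrite /torque mulKVmx ?Bt_unit//.
rewrite [X in X = _ -> _]mxE.
rewrite [X in _ = X -> _]mxE.
rewrite (Mt_mulE S _ (derive1 (tr_v tr) t)).
rewrite Ct_mulE.
rewrite [(_ + Ct _ _ _ *m _) _ _]mxE Ct_mulE [(_ + Mt _ _ *m _) _ _]mxE Mt_mulE.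
have := mulmx_diag_posdef KPpd (tr_e tr t) i; rewrite mxE => hP.
have := mulmx_diag_posdef KIpd (tr_eta tr t) i; rewrite mxE => hI.
rewrite !mxE -!derive1E hP hI !mxE.
move: (\sum_j _) (fun_of_matrix (derive1 (tr_v tr) t) i 0)
  (fun_of_matrix (derive1 (tr_vd tr) t) i 0) (Mdiag _ _ _) (Mdiag _ _ _)
  (Cdiag _ _ _ _) (Cdiag _ _ _ _) (tr_v _ _ _ _) (tr_vd _ _ _ _) (tr_eta _ _ _ _)
  (sy_KP _ _ _) (sy_KI _ _ _) => *; lra.
Qed.

(** In the cross term, [M' = 2 C] meets only one [- C] from the error dynamics. The surviving
    [C e eta] is what puts [c_c] into [chi]. *)
Lemma is_derive_Wtr (t : R) : 0 < t ->
  is_derive t 1 (Wtr S delta tr)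
  (\sum_i (- (sy_KP S i i * tr_e tr t i 0 ^+ 2) + tr_e tr t i 0 * residual t i 0
    + delta * ((Cdiag S (tr_q tr t) (tr_v tr t) i - sy_KP S i i)
                 * (tr_e tr t i 0 * tr_eta tr t i 0)
               - sy_KI S i i * tr_eta tr t i 0 ^+ 2
               + residual t i 0 * tr_eta tr t i 0
               + Mdiag S (tr_q tr t) i * tr_e tr t i 0 ^+ 2))).
Proof.
move=> t0.
have -> : Wtr S delta tr = \sum_i (fun s =>
    2^-1 * (Mdiag S (tr_q tr s) i * (tr_e tr s i 0 * tr_e tr s i 0))
    + sy_KI S i i / 2 * (tr_eta tr s i 0 * tr_eta tr s i 0)
    + delta * (Mdiag S (tr_q tr s) i * (tr_e tr s i 0 * tr_eta tr s i 0))).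
  apply/funext => s; rewrite fct_sumE /Wtr Wfun_sum//.
  by apply: eq_bigr => i _; field.
apply: is_derive_sum => i.
have hM := is_derive_Mdiag i (cl_q cl t0).
have [de [hde deE]] := error_dynamics i t0.
have heta := is_derive_coord i (cl_eta cl t0).
apply: (is_derive_eq (is_derive_add (is_derive_add
  (is_derive_mulc 2^-1 (is_derive_mul hM (is_derive_mul hde hde)))
  (is_derive_mulc (sy_KI S i i / 2) (is_derive_mul heta heta)))
  (is_derive_mulc delta (is_derive_mul hM (is_derive_mul hde heta))))).
set e := tr_e tr t i 0 in deE *; set y := tr_eta tr t i 0 in deE *.
set m := Mdiag _ _ _ in deE *; set c := Cdiag _ _ _ _ in deE *.
(* All occurrences of [de] are gathered into one multiple of [m * de], where the error equation can
   be substituted. *)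
transitivity (m * de * (e + delta * y) + c * e ^+ 2 + sy_KI S i i * e * y
   + delta * (2 * c * (e * y) + m * e ^+ 2)); first by field.
by rewrite deE; ring.
Qed.

Hypothesis refs : references_bounded S.

Lemma norm2_vd_le (t : R) : 0 <= t -> norm2 (tr_vd tr t) <= V_d S.
Proof. by move=> t0; apply: ub_le_sup; [exact: refs.1|exists tr, t]. Qed.

Lemma norm2_dvd_le (t : R) : 0 < t -> norm2 (derive1 (tr_vd tr) t) <= A_d S.
Proof. by move=> t0; apply: ub_le_sup; [exact: refs.2|exists tr, t]. Qed.

Lemma V_d_ge0 : 0 <= V_d S.
Proof. exact: le_trans (norm2_ge0 _) (norm2_vd_le (lexx 0)). Qed.

Lemma norm2_steer_le (q q' : 'cV[R]_6) :
  norm2 (pair2 (q' ix_df 0 - q ix_df 0) (q' ix_dr 0 - q ix_dr 0)) <= norm2 (q - q').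
Proof.
apply: norm2_le_sqr; first exact: norm2_ge0.
rewrite norm2_sqr_quad weighted_quadE norm2_pair2 sqr_sqrtr ?addr_ge0 ?sqr_ge0// !mxE.
have := sqr_ge0 (q ix_x 0 - q' ix_x 0); have := sqr_ge0 (q ix_y 0 - q' ix_y 0).
have := sqr_ge0 (q ix_th 0 - q' ix_th 0); have := sqr_ge0 (q ix_phi 0 - q' ix_phi 0).
set a := _ - _; set b := _ - _; set c := _ - _; set d := _ - _.
rewrite -(opprB (q' ix_df 0)) -(opprB (q' ix_dr 0)) !sqrrN.
set f := _ - _; set g := _ - _; move: a b c d f g => a b c d f g; lra.
Qed.

Lemma norm2_rate_le (v v' : 'cV[R]_3) :
  norm2 (pair2 (v' iv_f 0 - v iv_f 0) (v' iv_r 0 - v iv_r 0)) <= norm2 (v - v').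
Proof.
apply: norm2_le_sqr; first exact: norm2_ge0.
rewrite norm2_sqr3 norm2_pair2 sqr_sqrtr ?addr_ge0 ?sqr_ge0// !mxE.
have := sqr_ge0 (v 0 0 - v' 0 0).
by rewrite -(opprB (v' iv_f 0)) -(opprB (v' iv_r 0)) !sqrrN -addrA lerDr.
Qed.

(** The uncertainty is first moved from [v] to [v_d] at the price [d_v |e|]; at [v_d] it is bounded
    by the free parameter [Ac]. *)
Lemma residual_le (t Ac : R) : 0 < t -> dv_property S ->
  norm2 (ftilde S (tr_q tr t) (tr_vd tr t)) <= Ac ->
  norm2 (residual t) <= A_q S * norm2 (tr_q tr t - tr_qd tr t) + Ac
    + (A_v S + const_dv S) * norm2 (tr_e tr t).
Proof.
move=> t0 [_ hdv] hAc; have t0' := ltW t0.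
have [Xq _ [Df Dr] [wf wr]] := cl_op cl t0'.
have [_ _ [Dfd Drd] [wfd wrd]] := cl_opd cl t0'.
have Ditv : is_interval (sy_Ddelta S) by case: S_ok => _ _ _ [].
have LM0 := const_LM_ge0 S; have LC10 := const_LC1_ge0 S; have LC20 := const_LC2_ge0 S.
have Vd0 := V_d_ge0.
set Q := norm2 (_ - tr_qd tr t); set E := norm2 (tr_e tr t).
have Q0 : 0 <= Q := norm2_ge0 _.
have E0 : 0 <= E := norm2_ge0 _.
have hM i : `|Mdiag S (tr_qd tr t) i - Mdiag S (tr_q tr t) i| <= const_LM S * Q.
  have LQ0 := mulr_ge0 LM0 Q0.
  rewrite /Mdiag; case: i => -[|[|[|]]]//= _; rewrite ?subrr ?normr0//.
  apply: (le_trans (M11_lipschitz p_pos Ditv Df Dr Dfd Drd)).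
  by rewrite ler_wpM2l// norm2_steer_le.
have hC i : `|Cdiag S (tr_qd tr t) (tr_vd tr t) i - Cdiag S (tr_q tr t) (tr_v tr t) i|
    <= const_LC1 S * Q + const_LC2 S * E.
  have LQ0 := addr_ge0 (mulr_ge0 LC10 Q0) (mulr_ge0 LC20 E0).
  rewrite /Cdiag; case: i => -[|[|[|]]]//= _; rewrite ?subrr ?normr0//.
  apply: (le_trans (C11_lipschitz p_pos Ditv (tr_vd tr t iv_f 0)
    (tr_vd tr t iv_r 0) Df Dr Dfd Drd wf wr)).
  exact: (lerD (ler_wpM2l LC10 (norm2_steer_le _ _)) (ler_wpM2l LC20 (norm2_rate_le _ _))).
have h1 := norm2_wcol_le (derive1 (tr_vd tr) t) (mulr_ge0 LM0 Q0) hM.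
have h2 := norm2_wcol_le (tr_vd tr t)
  (addr_ge0 (mulr_ge0 LC10 Q0) (mulr_ge0 LC20 E0)) hC.
have h3 : norm2 (- ftilde S (tr_q tr t) (tr_v tr t)) <= Ac + const_dv S * E.
  rewrite norm2N -[X in norm2 X](subrKC (ftilde S (tr_q tr t) (tr_vd tr t))).
  rewrite (le_trans (norm2_triangle _ _))// lerD//.
  by rewrite -norm2N opprB hdv.
have [_ [r0 _ _]] := p_pos; have sJ := sigma_J_ge1 r0 Xq.
have hAd := ler_wpM2l (mulr_ge0 LM0 Q0) (norm2_dvd_le t0).
have hVd := ler_wpM2l (addr_ge0 (mulr_ge0 LC10 Q0) (mulr_ge0 LC20 E0)) (norm2_vd_le t0').
have hs := mulr_ge0 (mulr_ge0 (mulr_ge0 LC20 (sigma_dJ_ge0 S)) (sqr_ge0 (V_d S))) Q0.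
have hJ : const_LC2 S * E * V_d S <= const_LC2 S * E * V_d S * sigma_J S.
  exact: (ler_peMr (mulr_ge0 (mulr_ge0 LC20 E0) Vd0) sJ).
rewrite /residual (le_trans (norm2_triangle _ _))//.
apply: (le_trans (lerD (norm2_triangle _ _) (lexx _))).
rewrite /A_q /A_v; clear -hAd hVd hs hJ h1 h2 h3; move: hAd hVd hs hJ h1 h2 h3.
move: (norm2 (\col_i _)) (norm2 (\col_i _)) (norm2 (- _)) (norm2 (derive1 _ _))
  (norm2 (tr_vd tr t)) (const_LM S) (const_LC1 S) (const_LC2 S) (sigma_J S)
  (sigma_dJ S) (V_d S) (A_d S) (const_dv S) E Q.
clear => *; lra.
Qed.

(** [chi] is the total coefficient of [|e| |eta|] in the cross term: [c_c] and [lambda_max] from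
    [C - K_P], [A_v + d_v] from the residual. The term [delta e^T M e] contributes [a_2]. *)
Lemma derive1_Wtr_le (t Ac : R) : 0 < t -> 0 < mu0 S -> 0 <= delta -> dv_property S ->
  norm2 (ftilde S (tr_q tr t) (tr_vd tr t)) <= Ac ->
  derive1 (Wtr S delta tr) t <=
  - (mu0 S / 2 - delta * (const_a2 S + chi S ^+ 2 / lambda_min (sy_KI S)))
    * norm2 (tr_e tr t) ^+ 2
  - delta / 4 * lambda_min (sy_KI S) * norm2 (tr_eta tr t) ^+ 2
  + (A_q S ^+ 2 / mu0 S + delta * (A_q S ^+ 2 / lambda_min (sy_KI S)))
    * norm2 (tr_q tr t - tr_qd tr t) ^+ 2
  + (Ac ^+ 2 / mu0 S + delta * (Ac ^+ 2 / lambda_min (sy_KI S))).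
Proof.
move=> t0 mu_gt0 d0 hdv hAc; have [_ _ _ [wf wr]] := cl_op cl (ltW t0).
rewrite derive1E; have [_ ->] := is_derive_Wtr t0.
rewrite !(big_split, =^~ mulr_sumr)/= !sumrN.
have hr := residual_le t0 hdv hAc.
set e := tr_e tr t in hr *; set y := tr_eta tr t; set r := residual t in hr *.
set Q := norm2 (_ - tr_qd tr t) in hr *.
have er := dot_le_norm2 e r; have ry := dot_le_norm2 r y.
rewrite /dot in er ry.
have P1 := wdot_ge e (lambda_min_le KPpd).
have P2 : \sum_i (Cdiag S (tr_q tr t) (tr_v tr t) i - sy_KP S i i) * (e i 0 * y i 0)
    <= (const_cc S + lambda_max (sy_KP S)) * (norm2 e * norm2 y).
  apply: wdot_le => i; rewrite (le_trans (ler_normB _ _))// lerD//.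
    exact: Cdiag_norm.
  by rewrite ger0_norm ?le_lambda_max// ltW// diag_posdef_diag.
have I1 := wdot_ge y (lambda_min_le KIpd).
have M1 := wdot_sqr_le e (const_a2_ge p_pos (tr_q tr t)).
have lI := lambda_min_gt0 KIpd 0.
have E0 := norm2_ge0 e; have H0 := norm2_ge0 y.
set E := norm2 e in er hr P1 P2 M1 E0 *; set H := norm2 y in ry P2 I1 H0 *.
have eb := le_trans er (ler_wpM2l E0 hr).
have yb := le_trans ry (ler_wpM2r H0 hr).
(* Each product costs a quarter of [mu0], leaving the [mu0 / 2] of [c_1]. *)
have e1 := peter_paul E (A_q S * Q) mu_gt0; have e2 := peter_paul E Ac mu_gt0.
(* Together with the [chi] product, three quarters of [lambda_min] of [K_I] are spent, leaving the
   quarter in [c_2]. *)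
have y1 := peter_paul H (A_q S * Q) lI; have y2 := peter_paul H Ac lI.
have y3 := peter_paul H (chi S * E) lI.
set lI' := lambda_min (sy_KI S) in I1 lI y1 y2 y3 *.
have I1' := I1; rewrite -lerN2 in I1'.
have inner := ler_wpM2l d0 (lerD (lerD (lerD P2 I1') yb) M1).
have hmu : mu0 S * E ^+ 2 =
  (lambda_min (sy_KP S) - A_v S - const_dv S) * E ^+ 2 by [].
have hchi : delta * (H * (chi S * E)) = delta *
  (H * ((const_cc S + lambda_max (sy_KP S) + const_dv S + A_v S) * E)) by [].
have {}y1 := ler_wpM2l d0 y1; have {}y2 := ler_wpM2l d0 y2.
have {}y3 := ler_wpM2l d0 y3.
clear -P1 eb e1 e2 y1 y2 y3 inner hmu hchi.
move: P1 eb e1 e2 y1 y2 y3 inner hmu hchi.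
move: (\sum_i _) (\sum_i _) (\sum_i _) (\sum_i _) (\sum_i _) (\sum_i _).
move: E H Q lI' (mu0 S) (chi S) (A_q S) (A_v S) (const_dv S) (const_a2 S) (const_cc S)
  (lambda_min _) (lambda_max _) => *.
lra.
Qed.

End lyapunov_derivative.

(** * Lyapunov constants and Gronwall *)

Section lyapunov_bounds.
Context {R : realType} (S : system R) (delta : R).
Let p := sy_rb S.
Hypothesis S_ok : system_ok S.
Hypothesis delta_gt0 : 0 < delta.

Let p_pos : robot_pos p. Proof. by case: S_ok. Qed.
Let KIpd : diag_posdef (sy_KI S). Proof. by case: S_ok => _ _ _ _ []. Qed.

(** The cross term is at most [delta a_2 |e| |eta|], hence at most [delta a_2 / 2] times
    [|e|^2 + |eta|^2], which shifts both quadratic coefficients by the same amount. *)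
Lemma Wfun_bounds q (e eta : 'cV[R]_3) :
  let k := explicit_constants S delta in
  k_lo k * norm2 (col_mx e eta) ^+ 2 <= Wfun S delta q e eta
    <= k_up k * norm2 (col_mx e eta) ^+ 2.
Proof.
rewrite /= Wfun_sum// !big_split/= -!mulr_suml -mulr_sumr norm2_col_mx.
have M1 := wdot_ge e (const_a1_le p_pos q).
have M2 := wdot_sqr_le e (const_a2_ge p_pos q).
have I1 := wdot_ge eta (lambda_min_le KIpd).
have I2 := wdot_sqr_le eta (le_lambda_max KIpd).
have C1 := wdot_le e eta (Mdiag_norm p_pos q).
have C2 : \sum_i Mdiag S q i * (- (e i 0 * eta i 0)) <= const_a2 S * (norm2 e * norm2 eta).
  rewrite -(norm2N e); apply: le_trans (wdot_le _ _ (Mdiag_norm p_pos q)).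
  by apply: ler_sum => i _; rewrite mxE mulNr.
have a20 := const_a2_gt0 p_pos.
rewrite (eq_bigr (fun i => - (Mdiag S q i * (e i 0 * eta i 0)))) in C2; last first.
  by move=> i _; rewrite mulrN.
rewrite sumrN in C2.
set lo := Num.min _ _; set up := Num.max _ _.
have lo1 : lo <= const_a1 S - delta * const_a2 S by rewrite ge_min lexx.
have lo2 : lo <= lambda_min (sy_KI S) - delta * const_a2 S by rewrite ge_min lexx orbT.
have up1 : const_a2 S + delta * const_a2 S <= up by rewrite le_max lexx.
have up2 : lambda_max (sy_KI S) + delta * const_a2 S <= up by rewrite le_max lexx orbT.
have xy : norm2 e * norm2 eta <= (norm2 e ^+ 2 + norm2 eta ^+ 2) / 2.
  have := sqr_ge0 (norm2 e - norm2 eta).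
  by move: (norm2 e) (norm2 eta) => x y; lra.
have {}xy := ler_wpM2l (mulr_ge0 (ltW delta_gt0) (ltW a20)) xy.
have {}C1 := ler_wpM2l (ltW delta_gt0) C1; have {}C2 := ler_wpM2l (ltW delta_gt0) C2.
have {}lo1 := ler_wpM2r (sqr_ge0 (norm2 e)) lo1.
have {}lo2 := ler_wpM2r (sqr_ge0 (norm2 eta)) lo2.
have {}up1 := ler_wpM2r (sqr_ge0 (norm2 e)) up1.
have {}up2 := ler_wpM2r (sqr_ge0 (norm2 eta)) up2.
clear -M1 M2 I1 I2 C1 C2 xy lo1 lo2 up1 up2.
move: M1 M2 I1 I2 C1 C2 xy lo1 lo2 up1 up2.
move: lo up (\sum_i _) (\sum_i _) (\sum_i _) (norm2 e) (norm2 eta)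
  (const_a1 S) (const_a2 S) (lambda_min _) (lambda_max _) => *.
by apply/andP; split; lra.
Qed.

Hypotheses (refs : references_bounded S) (hdv : dv_property S).
Hypothesis mu_gt0 : 0 < mu0 S.
Hypothesis hdelta : delta <
  Num.min (Num.min (const_a1 S) (lambda_min (sy_KI S)) / const_a2 S)
          (mu0 S / (2 * const_a2 S + 2 * chi S ^+ 2 / lambda_min (sy_KI S))).

(** The first bound on [delta] makes W positive definite; the second is exactly the positivity of
    [c_1]. *)
Lemma explicit_constants_gt0 : let k := explicit_constants S delta in
  [/\ 0 < k_lo k, 0 < k_up k, 0 < k_1 k & 0 < k_2 k].
Proof.
have a2 := const_a2_gt0 p_pos; have lI := lambda_min_gt0 KIpd 0.
have LI : 0 < lambda_max (sy_KI S).
  exact: lt_le_trans (diag_posdef_diag KIpd 0) (le_lambda_max KIpd 0).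
have d2 : 0 < delta * const_a2 S by rewrite mulr_gt0.
have chi2 : 0 <= chi S ^+ 2 / lambda_min (sy_KI S) by rewrite divr_ge0 ?sqr_ge0// ltW.
move: hdelta; rewrite lt_min ltr_pdivlMr// lt_min => /andP[/andP[h1 h2] h3].
rewrite ltr_pdivlMr in h3; last by rewrite -mulrA; lra.
split => /=.
- by rewrite divr_gt0// lt_min !subr_gt0 h1 h2.
- by rewrite divr_gt0// lt_max addr_gt0.
- by move: h3; rewrite -mulrA; lra.
- by rewrite mulr_gt0// divr_gt0.
Qed.

(* The explicit constants, with [A_c] replaced by an arbitrary bound of the
   uncertainty along the reference velocity. *)
Definition constants_of (Ac : R) : constants R :=
  let k := explicit_constants S delta in
  Constants (k_lo k) (k_up k) (k_1 k) (k_2 k) (k_3 k)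
    (Ac ^+ 2 / mu0 S + delta * (Ac ^+ 2 / lambda_min (sy_KI S))).

Lemma lyapunov_constants_of (Ac : R) :
  (forall tr t, closed_loop S tr -> 0 < t ->
    norm2 (ftilde S (tr_q tr t) (tr_vd tr t)) <= Ac) ->
  lyapunov_constants S delta (constants_of Ac).
Proof.
move=> hAc; have k_ge0 x : 0 <= x ^+ 2 / mu0 S
    + delta * (x ^+ 2 / lambda_min (sy_KI S)).
  apply: addr_ge0 (divr_ge0 (sqr_ge0 x) (ltW mu_gt0)) (mulr_ge0 (ltW delta_gt0) _).
  exact: divr_ge0 (sqr_ge0 x) (ltW (lambda_min_gt0 KIpd 0)).
split.
- exact: explicit_constants_gt0.
- by split; exact: k_ge0.
- by move=> q e eta _ _ _; have /andP[] := Wfun_bounds q e eta.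
- move=> tr t cl t0; apply: derive1_Wtr_le => //; [exact: ltW|exact: hAc].
Qed.

Lemma lyapunov_constants_weaken (k : constants R) (a3 a4 : R) :
  lyapunov_constants S delta k -> k_3 k <= a3 -> k_4 k <= a4 ->
  lyapunov_constants S delta (Constants (k_lo k) (k_up k) (k_1 k) (k_2 k) a3 a4).
Proof.
move=> [kpos [k3 k4] kW kD] h3 h4; split => //=.
  by rewrite (le_trans k3)// (le_trans k4).
move=> tr t cl t0; apply: (le_trans (kD tr t cl t0)).
by rewrite lerD// lerD2l ler_wpM2r// sqr_ge0.
Qed.

Lemma lyapunov_constants_explicit : ftilde_estimate S ->
  lyapunov_constants S delta (explicit_constants S delta).
Proof.
move=> est; apply: (lyapunov_constants_of (Ac := A_c S)) => tr t cl t0.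
apply: (le_trans (est tr t cl (ltW t0))); rewrite lerD2l ler_wpM2l//.
  by rewrite mulr_ge0 ?sqr_ge0 ?norm2_ge0.
exact: (norm2_vd_le cl refs (ltW t0)).
Qed.

Let r_gt0 : 0 < rb_r p. Proof. by have [_ []] := p_pos. Qed.
Let unc : uncertainty_ok S. Proof. by case: S_ok. Qed.

(** Uses [Jbound] in place of [sigma_J], hence valid for every wheel radius. *)
Lemma norm2_ftilde_vd_le tr (t : R) : closed_loop S tr -> 0 <= t ->
  norm2 (ftilde S (tr_q tr t) (tr_vd tr t)) <=
  Jbound p * (norm2 (c_vec S) + norm2 (d_vec S) * V_d S * Jbound p).
Proof.
move=> cl t0; have [Xq _ _ _] := cl_op cl t0.
have J0 : 0 <= Jbound p := sqrtr_ge0 _.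
apply: (le_trans (norm2_ftilde_le unc _ J0 (norm2_Jmx_le p _) Xq)).
apply: (ler_wpM2l J0); rewrite lerD2l -mulrA; apply: (ler_wpM2l (norm2_ge0 _)).
by rewrite mulrC; apply: (ler_wpM2r J0); exact: norm2_vd_le.
Qed.

Lemma exists_constants_pos :
  exists k, constants_pos k /\ lyapunov_constants S delta k.
Proof.
have h := lyapunov_constants_of (fun tr t cl t0 => norm2_ftilde_vd_le cl (ltW t0)).
set k := constants_of _ in h; have [kpos [k3 k4] _ _] := h.
(* [k_3] and [k_4] may be 0; adding 1 makes them positive and only weakens the estimate. *)
exists (Constants (k_lo k) (k_up k) (k_1 k) (k_2 k) (k_3 k + 1) (k_4 k + 1)); split.
  by split=> //=; rewrite !ltr_wpDl.
by apply: lyapunov_constants_weaken; rewrite // lerDl.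
Qed.

(* As [1 <= sigma_J S], both [c_vec S] and [norm2 (d_vec S) * V_d S] vanish, and
   the crude bound of the uncertainty is 0 whatever the wheel radius is. *)
Lemma ftilde_estimate_A_c0 : A_c S = 0 -> ftilde_estimate S.
Proof.
move=> Ac0 tr t cl t0; have [Xq _ _ _] := cl_op cl t0.
have s1 := sigma_J_ge1 r_gt0 Xq; have s0 : 0 < sigma_J S := lt_le_trans ltr01 s1.
have Vd0 := V_d_ge0 cl refs.
have ct0 : 0 <= c_tilde S := mulr_ge0 (ltW s0) (norm2_ge0 _).
have dt0 : 0 <= d_tilde S := mulr_ge0 (sqr_ge0 _) (norm2_ge0 _).
move/eqP : Ac0; rewrite (paddr_eq0 ct0 (mulr_ge0 dt0 Vd0)) => /andP[c0 dV0].
have c_vec0 : norm2 (c_vec S) = 0.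
  by move: c0; rewrite mulf_eq0 gt_eqF//= => /eqP.
have dV : norm2 (d_vec S) * V_d S = 0.
  by apply/eqP; move: dV0; rewrite /d_tilde -mulrA mulf_eq0 sqrf_eq0 gt_eqF.
apply: (le_trans (norm2_ftilde_vd_le cl t0)).
rewrite c_vec0 dV mul0r addr0 mulr0.
exact: addr_ge0 ct0 (mulr_ge0 dt0 (norm2_ge0 _)).
Qed.

End lyapunov_bounds.

(** * Continuity up to the initial time and comparison lemmas *)

Section trajectory_continuity.
Context {R : realType} (S : system R) (delta : R) (tr : trajectory R).
Hypothesis KIpd : diag_posdef (sy_KI S).
Hypothesis cl : closed_loop S tr.

Lemma cvg_coord (F : set_system R) {FF : Filter F} n (f : R -> 'cV[R]_n) (l : 'cV[R]_n) i :
  f @ F --> l -> f x i 0 @[x --> F] --> l i 0.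
Proof.
by move=> fl; exact: (cvg_comp _ _ fl (@coord_continuous _ _ _ i 0 l)).
Qed.

Lemma Wtr_continuous : {within [set t : R | 0 <= t], continuous (Wtr S delta tr)}.
Proof.
apply/subspace_continuousP => x x0.
have [/subspace_continuousP/(_ x x0) cq /subspace_continuousP/(_ x x0) cv
  /subspace_continuousP/(_ x x0) ceta _ /subspace_continuousP/(_ x x0) cvd] := cl_cont cl.
have -> : Wtr S delta tr = fun s => \sum_i
    (Mdiag S (tr_q tr s) i * tr_e tr s i 0 ^+ 2 / 2
     + sy_KI S i i * tr_eta tr s i 0 ^+ 2 / 2
     + delta * (Mdiag S (tr_q tr s) i * (tr_e tr s i 0 * tr_eta tr s i 0))).
  by apply/funext => s; rewrite /Wtr Wfun_sum.
set F := within _ _ in cq cv ceta cvd *.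
have ce i : tr_e tr s i 0 @[s --> F] --> tr_e tr x i 0.
  by apply: cvg_coord; exact: cvgB.
have cM i : Mdiag S (tr_q tr s) i @[s --> F] --> Mdiag S (tr_q tr x) i.
  have hf : tr_q tr s ix_df 0 @[s --> F] --> tr_q tr x ix_df 0 by exact: cvg_coord.
  have hr : tr_q tr s ix_dr 0 @[s --> F] --> tr_q tr x ix_dr 0 by exact: cvg_coord.
  rewrite /Mdiag; case: i => -[|[|[|]]]//= _; [|exact: cvg_cst|exact: cvg_cst].
  have hc : cos (tr_q tr s ix_df 0 - tr_q tr s ix_dr 0) @[s --> F]
      --> cos (tr_q tr x ix_df 0 - tr_q tr x ix_dr 0).
    exact: (cvg_comp _ _ (cvgB hf hr) (@continuous_cos _ _)).
  have hs : sin (tr_q tr s ix_df 0) - sin (tr_q tr s ix_dr 0) @[s --> F]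
      --> sin (tr_q tr x ix_df 0) - sin (tr_q tr x ix_dr 0).
    exact: cvgB (cvg_comp _ _ hf (@continuous_sin _ _))
                (cvg_comp _ _ hr (@continuous_sin _ _)).
  apply: cvgD; last by apply: cvgMr; exact: cvgM.
  by apply: cvgD; [exact: cvg_cst|apply: cvgMr; apply: cvgD => //; exact: cvg_cst].
apply: cvg_big => [|i _]; first exact: add_continuous.
have cy : tr_eta tr s i 0 @[s --> F] --> tr_eta tr x i 0 by exact: cvg_coord.
apply: cvgD; last by apply: cvgMr; apply: cvgM => //; exact: cvgM.
apply: cvgD; apply: cvgMl.
  by apply: cvgM => //; exact: cvgM.
by apply: cvgMr; exact: cvgM.
Qed.

End trajectory_continuity.

Lemma gronwall (R : realType) (f : R -> R) (lam rho : R) : 0 < lam ->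
  {within [set t : R | 0 <= t], continuous f} ->
  (forall t, 0 < t -> derivable f t 1 /\ derive1 f t <= - lam * f t + rho) ->
  forall t, 0 <= t ->
  f t <= expR (- lam * t) * f 0 + rho / lam * (1 - expR (- lam * t)).
Proof.
move=> lam0 fc fd t t0.
(* The integrating factor makes g nonincreasing on [[0, t]]: its derivative is a nonpositive
   multiple of an exponential on the open interval, and continuity reaches the endpoint 0. *)
pose g (s : R) := (f s - rho / lam) * expR (lam * s).
have dg (s : R) : 0 < s ->
    is_derive s 1 g ((derive1 f s + lam * f s - rho) * expR (lam * s)).
  move=> s0; have [df _] := fd s s0.
  have hf : is_derive s 1 f (derive1 f s) by rewrite derive1E; exact: derivableP.
  have he : is_derive s 1 (fun s => expR (lam * s)) (expR (lam * s) * (lam * 1)).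
    exact: (is_derive1_comp (is_derive_expR _) (is_derive_mulc lam (is_derive_id s 1))).
  apply: (is_derive_eq (is_derive_mul
    (is_derive_sub hf (is_derive_cst (rho / lam) s 1)) he)).
  by rewrite /=; field; rewrite gt_eqF.
have gc : {within `[0, t], continuous g}.
  apply/subspace_continuousP => x; rewrite /= in_itv/= => /andP[x0 xt].
  have fx : f y @[y --> within `[0, t] (nbhs x)] --> f x.
    have /subspace_continuousP : {within `[0, t], continuous f}.
      by apply: continuous_subspaceW fc => y; rewrite /= in_itv/= => /andP[].
    by apply; rewrite /= in_itv/= x0.
  apply: cvgM; first by apply: cvgB => //; exact: cvg_cst.
  apply: cvg_within_filter; apply: continuous_cvg; first exact: continuous_expR.
  by apply: cvgMr; exact: cvg_id.
have := @ler0_derive1_nincr R g 0 t _ _ gc 0 t (lexx _) t0 (lexx _).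
rewrite /g mulr0 expR0 mulr1 => h.
have {}h : (f t - rho / lam) * expR (lam * t) <= f 0 - rho / lam.
  apply: h => x; rewrite in_itv/= => /andP[x0 _]; first by have [] := dg x x0.
  rewrite derive1E; have [_ ->] := dg x x0; rewrite mulr_le0_ge0 ?expR_ge0//.
  by have [_] := fd x x0; lra.
have hE : expR (lam * t) * expR (- lam * t) = 1.
  by rewrite -expRD mulNr subrr expR0.
have := ler_wpM2r (expR_ge0 (- lam * t)) h.
by rewrite -[X in X <= _]mulrA hE; lra.
Qed.

(** The limsup is an infimum over neighbourhoods of [+oo], of which [[T, +oo[] is one; [eps] is
    arbitrary. *)
Lemma limf_esup_pinfty_le (R : realType) (f : R -> R) (L : R) :
  (forall eps, 0 < eps -> exists T, forall t, T <= t -> f t <= L + eps) ->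
  (limf_esup (fun t : R => (f t)%:E) +oo%R <= L%:E)%E.
Proof.
move=> h; apply/lee_addgt0Pr => eps /h[T hT].
rewrite limf_esupE; apply: (@le_trans _ _ (ereal_sup [set (f t)%:E | t in [set t | T <= t]])).
  apply: ereal_inf_lbound; exists [set t | T <= t] => //.
  exact: nbhs_pinfty_ge (num_real T).
by apply: ge_ereal_sup => _ [t /= Tt <-]; rewrite -EFinD lee_fin hT.
Qed.

(** From [1 + x <= e^x], [K <= lam eps t <= eps e^(lam t)]: an explicit decay time without
    logarithms. *)
Lemma mulr_expRN_le (R : realType) (K lam eps t : R) : 0 <= K -> 0 < lam ->
  0 < eps -> K / (lam * eps) <= t -> K * expR (- lam * t) <= eps.
Proof.
move=> K0 lam0 eps0; rewrite ler_pdivrMr ?mulr_gt0// => h.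
rewrite mulNr expRN ler_pdivrMr ?expR_gt0//.
have := ler_wpM2l (ltW eps0) (expR_ge1Dx (lam * t)); lra.
Qed.

(** * Ultimate bounds *)

Section ultimate_bounds.
Context {R : realType} (S : system R) (delta qbar : R) (k : constants R).
Hypothesis S_ok : system_ok S.
Hypothesis kL : lyapunov_constants S delta k.
Hypothesis qbar_ge0 : 0 <= qbar.

Let c := Num.min (k_1 k) (k_2 k).
Let rho := k_3 k * qbar ^+ 2 + k_4 k.
Let lam := c / k_up k.
Let F := error_bounded S qbar.

Let lo_gt0 : 0 < k_lo k. Proof. by case: kL => -[]. Qed.
Let up_gt0 : 0 < k_up k. Proof. by case: kL => -[]. Qed.
Let c_gt0 : 0 < c. Proof. by case: kL => -[_ _ k1 k2 _ _ _]; rewrite lt_min k1. Qed.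
Let lam_gt0 : 0 < lam. Proof. exact: divr_gt0. Qed.
Let rho_ge0 : 0 <= rho.
Proof.
by case: kL => _ [k3 k4] _ _; exact: addr_ge0 (mulr_ge0 k3 (sqr_ge0 _)) k4.
Qed.

Lemma Wtr_bounds tr (t : R) : closed_loop S tr -> 0 <= t ->
  k_lo k * norm2 (tr_z tr t) ^+ 2 <= Wtr S delta tr t
    <= k_up k * norm2 (tr_z tr t) ^+ 2.
Proof.
move=> cl t0; have [Xq _ [Df Dr] _] := cl_op cl t0.
by case: kL => _ _ /(_ _ (tr_e tr t) (tr_eta tr t) Xq Df Dr)[h1 h2] _; rewrite h1.
Qed.

Lemma derivable_Wtr tr (t : R) : closed_loop S tr -> 0 < t ->
  derivable (Wtr S delta tr) t 1.
Proof. by move=> cl t0; have [] := is_derive_Wtr delta S_ok cl t0. Qed.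

Lemma derive1_Wtr_norm tr (t : R) : F tr -> 0 < t ->
  derive1 (Wtr S delta tr) t <= - c * norm2 (tr_z tr t) ^+ 2 + rho.
Proof.
move=> [cl hq] t0; case: kL => _ [k3 _] _ /(_ tr t cl t0)/le_trans; apply.
have c1 : c <= k_1 k by rewrite ge_min lexx.
have c2 : c <= k_2 k by rewrite ge_min lexx orbT.
have h1 := ler_wpM2r (sqr_ge0 (norm2 (tr_e tr t))) c1.
have h2 := ler_wpM2r (sqr_ge0 (norm2 (tr_eta tr t))) c2.
have : norm2 (tr_q tr t - tr_qd tr t) ^+ 2 <= qbar ^+ 2.
  by rewrite ler_pXn2r ?nnegrE ?norm2_ge0//; exact: hq (ltW t0).
move=> /(ler_wpM2l k3) h3.
rewrite norm2_col_mx /rho; move: h1 h2 h3.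
move: (norm2 (tr_e tr t)) (norm2 (tr_eta tr t))
  (norm2 (tr_q tr t - tr_qd tr t)) => x y z; lra.
Qed.

Lemma derive1_Wtr_self tr (t : R) : F tr -> 0 < t ->
  derive1 (Wtr S delta tr) t <= - lam * Wtr S delta tr t + rho.
Proof.
move=> Ftr t0; apply: (le_trans (derive1_Wtr_norm Ftr t0)); rewrite lerD2r.
have /andP[_ W2] := Wtr_bounds Ftr.1 (ltW t0).
rewrite !mulNr lerN2 /lam mulrAC ler_pdivrMr// -mulrA ler_wpM2l ?(ltW c_gt0)//.
by rewrite mulrC.
Qed.

Lemma Wtr_gronwall tr (t : R) : F tr -> 0 <= t ->
  Wtr S delta tr t <= expR (- lam * t) * Wtr S delta tr 0
    + k_up k / c * rho * (1 - expR (- lam * t)).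
Proof.
move=> Ftr t0; have KI : diag_posdef (sy_KI S) by case: S_ok => _ _ _ _ [].
have -> : k_up k / c * rho = rho / lam.
  by rewrite /lam; field; rewrite !gt_eqF.
apply: gronwall => //; first exact: Wtr_continuous KI Ftr.1.
by move=> s s0; split; [exact: derivable_Wtr Ftr.1 s0|exact: derive1_Wtr_self].
Qed.

(** W is compared with [|z|^2] from below at time t and from above at time 0, and the negative
    exponential part of the [rho] term is dropped. *)
Lemma norm2_z_sqr_le tr (t : R) : F tr -> 0 <= t ->
  norm2 (tr_z tr t) ^+ 2 <= k_up k / k_lo k * norm2 (tr_z tr 0) ^+ 2 * expR (- lam * t)
    + k_up k / k_lo k * (rho / c).
Proof.
move=> Ftr t0; have /andP[W1 _] := Wtr_bounds Ftr.1 t0.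
have /andP[_ W2] := Wtr_bounds Ftr.1 (lexx 0).
have h := le_trans W1 (Wtr_gronwall Ftr t0).
have E0 := expR_ge0 (- lam * t).
have h2 := ler_wpM2l E0 W2.
have r0 : 0 <= k_up k / c * rho := mulr_ge0 (ltW (divr_gt0 up_gt0 c_gt0)) rho_ge0.
have h3 := mulr_ge0 r0 E0.
have {h h2 h3}h : k_lo k * norm2 (tr_z tr t) ^+ 2 <=
    k_up k * norm2 (tr_z tr 0) ^+ 2 * expR (- lam * t) + k_up k / c * rho by lra.
rewrite -(ler_pM2l lo_gt0) (le_trans h)// le_eqVlt; apply/orP; left; apply/eqP.
by field; rewrite !gt_eqF.
Qed.

Lemma uub_error_bounded : uniformly_ultimately_bounded F.
Proof.
(* The asymptotic bound of [|z|^2] plus a margin that absorbs the transient and keeps the radius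
   positive when [rho = 0]. *)
pose b := k_up k / k_lo k + k_up k / k_lo k * (rho / c).
have kk : 0 < k_up k / k_lo k by rewrite divr_gt0.
have b0 : 0 < b.
  by rewrite /b -[ltLHS]addr0 ltr_leD// mulr_ge0 ?(ltW kk)// divr_ge0// ltW.
exists (Num.sqrt b); first by rewrite sqrtr_gt0.
(* After this time [rad^2 e^(- lam t) <= 1]; it depends on [rad] but not on the trajectory. *)
move=> rad rad0; exists (rad ^+ 2 / (lam * 1)).
  by rewrite divr_ge0 ?sqr_ge0// mulr_ge0// ltW.
move=> tr Ftr z0 t Tt.
have t0 : 0 <= t.
  by apply: le_trans Tt; rewrite divr_ge0 ?sqr_ge0// mulr_ge0// ltW.
apply: norm2_le_sqr; first exact: sqrtr_ge0.
rewrite (sqr_sqrtr (ltW b0)); apply: (le_trans (norm2_z_sqr_le Ftr t0)).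
rewrite /b lerD2r -mulrA ler_piMr ?(ltW kk)//.
apply: le_trans (mulr_expRN_le (sqr_ge0 rad) lam_gt0 ltr01 Tt).
by rewrite ler_wpM2r ?expR_ge0// ler_pXn2r ?nnegrE ?norm2_ge0 ?(ltW rad0).
Qed.

Lemma limsup_norm2_z tr : F tr ->
  (limf_esup (fun t : R => (norm2 (tr_z tr t))%:E) +oo%R
   <= (Num.sqrt (k_up k / k_lo k * (rho / c)))%:E)%E.
Proof.
move=> Ftr; apply: limf_esup_pinfty_le => eps eps0.
set L := _ * _; set K := k_up k / k_lo k * norm2 (tr_z tr 0) ^+ 2.
have kk : 0 <= k_up k / k_lo k by rewrite ltW// divr_gt0.
have L0 : 0 <= L by rewrite mulr_ge0// divr_ge0// ltW.
have K0 : 0 <= K by rewrite mulr_ge0// sqr_ge0.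
have eps20 : 0 < eps ^+ 2 by rewrite exprn_gt0.
(* The transient is below [eps^2] from here on, and [L + eps^2 <= (sqrt L + eps)^2]. *)
exists (K / (lam * eps ^+ 2)) => t Tt.
have t0 : 0 <= t.
  by apply: le_trans Tt; rewrite divr_ge0// mulr_ge0// ltW.
apply: norm2_le_sqr; first by rewrite addr_ge0 ?sqrtr_ge0// ltW.
apply: (le_trans (norm2_z_sqr_le Ftr t0)).
have := mulr_expRN_le K0 lam_gt0 eps20 Tt.
have := mulr_ge0 (sqrtr_ge0 L) (ltW eps0); have := sqr_sqrtr L0.
move: (Num.sqrt L) => s; rewrite -/K -/L => <-; lra.
Qed.

End ultimate_bounds.

(** A nominal trajectory has tracking error bounded by [qbar = 0], so with [k_4 = 0] the offset
    [rho] vanishes and only the transient remains. *)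
Lemma exponentially_stable_nominal (R : realType) (S : system R) (delta : R)
    (k : constants R) : system_ok S -> lyapunov_constants S delta k -> k_4 k = 0 ->
  exponentially_stable (nominal S).
Proof.
move=> S_ok kL k40; have [[lo0 up0 k10 k20] _ _ _] := kL.
set c := Num.min (k_1 k) (k_2 k); have c0 : 0 < c by rewrite lt_min k10.
have kk : 0 <= k_up k / k_lo k by rewrite ltW// divr_gt0.
(* The rate is halved on passing from [|z|^2] to [|z|]. *)
exists (Num.sqrt (k_up k / k_lo k)), (c / k_up k / 2); split.
- by rewrite sqrtr_gt0 divr_gt0.
- by rewrite !divr_gt0.
move=> tr [cl hq] t t0.
have Ftr : error_bounded S 0 tr.
  by split=> // s s0; rewrite hq// subrr norm20.
apply: norm2_le_sqr.
  by rewrite !mulr_ge0 ?sqrtr_ge0 ?expR_ge0 ?norm2_ge0.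
apply: (le_trans (norm2_z_sqr_le S_ok kL (lexx 0) Ftr t0)).
rewrite !exprMn (sqr_sqrtr kk).
have -> : expR (- (c / k_up k / 2) * t) ^+ 2 = expR (- (c / k_up k) * t).
  by rewrite expr2 -expRD; congr expR; field; rewrite gt_eqF.
rewrite expr0n mulr0 k40 addr0 mul0r mulr0 addr0 -/c.
by rewrite mulrAC.
Qed.

Theorem proposition2 (R : realType) (S : system R) (delta : R)
  (hS : system_ok S)
  (hdv : dv_property S)
  (href : references_bounded S)
  (hmu : 0 < mu0 S)
  (hdelta0 : 0 < delta)
  (hdelta : delta <
     Num.min (Num.min (const_a1 S) (lambda_min (sy_KI S)) / const_a2 S)
             (mu0 S / (2 * const_a2 S
                       + 2 * chi S ^+ 2 / lambda_min (sy_KI S)))) :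
  [/\ (* existence of the constants *)
      exists k, constants_pos k /\ lyapunov_constants S delta k,
      (* the explicit choice *)
      1 <= rb_r (sy_rb S) \/ ftilde_estimate S ->
        lyapunov_constants S delta (explicit_constants S delta),
      (* the bounds, for every choice of the constants *)
      forall (k : constants R) (qbar : R),
        lyapunov_constants S delta k -> 0 <= qbar ->
        let c := Num.min (k_1 k) (k_2 k) in
        let rho := k_3 k * qbar ^+ 2 + k_4 k in
        let F := error_bounded S qbar in
        [/\ forall tr, F tr -> forall t : R, 0 < t ->
              [/\ derivable (Wtr S delta tr) t 1,
                  derive1 (Wtr S delta tr) t
                    <= - c * norm2 (tr_z tr t) ^+ 2 + rho &
                  derive1 (Wtr S delta tr) t
                    <= - (c / k_up k) * Wtr S delta tr t + rho],
            forall tr, F tr -> forall t : R, 0 <= t ->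
              Wtr S delta tr t
              <= expR (- (c / k_up k) * t) * Wtr S delta tr 0
                 + k_up k / c * rho * (1 - expR (- (c / k_up k) * t)),
            uniformly_ultimately_bounded F &
            forall tr, F tr ->
              (limf_esup (fun t : R => (norm2 (tr_z tr t))%:E) +oo%R
               <= (Num.sqrt (k_up k / k_lo k * (rho / c)))%:E)%E] &
      (* the nominal case *)
      A_c S = 0 ->
        k_3 (explicit_constants S delta) * 0 ^+ 2
          + k_4 (explicit_constants S delta) = 0 /\
        exponentially_stable (nominal S)].
Proof.
split.
- exact: exists_constants_pos.
- have [[_ [r0 _ _]] _ unc _ _] := hS.
  by move=> [r1|est]; apply: lyapunov_constants_explicit => //;
    exact: ftilde_estimate_r_ge1.
- move=> k qbar kL qbar0 c rho F; split.
  + move=> tr Ftr t t0; split; first exact: derivable_Wtr Ftr.1 t0.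
      exact: derive1_Wtr_norm.
    exact: derive1_Wtr_self.
  + by move=> tr Ftr t t0; exact: Wtr_gronwall.
  + exact: (uub_error_bounded hS kL qbar0).
  + by move=> tr Ftr; exact: (limsup_norm2_z hS kL qbar0 Ftr).
(* [A_c = 0] yields the uncertainty estimate for any wheel radius, so the explicit constants apply,
   with [k_4 = 0]. *)
- move=> Ac0; have est := ftilde_estimate_A_c0 hS href Ac0.
  have k40 : k_4 (explicit_constants S delta) = 0.
    by rewrite /= Ac0 expr0n !mul0r mulr0 addr0.
  split; first by rewrite k40 expr0n mulr0 addr0.
  by apply: exponentially_stable_nominal k40 => //; exact: lyapunov_constants_explicit.
Qed.
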